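(* Let $(x_k,z_k)_{k\ge0}$ be the random iterates of the Augmented Lagrangian Sketching (ALS) method with fixed penalty $\rho>0$, started at $x_0\in\mathbb{R}^n$, $z_0\in\mathbb{R}^p$. Put $$\mu=\min\big\{\lambda_{\min}^+(\mathbb{E}_{\mathcal D}[B^{-1/2}ZB^{-1/2}]),\ \lambda_{\min}^+(\mathbb{E}_{\mathcal D}[G^{-1/2}WG^{-1/2}])\big\},$$ $$\eta=\max\big\{\lambda_{\max}(\mathbb{E}_{\mathcal D}[B^{-1/2}ZB^{-1/2}]),\ \lambda_{\max}(\mathbb{E}_{\mathcal D}[G^{-1/2}WG^{-1/2}])\big\}.$$ Then the sequences converge in the sense that $\mathbb{E}[\|x_k-x^*\|_B^2]\to0$ and $\mathbb{E}[\|z_k\|_G^2]\to0$, and for every $k\ge0$ $$\mathbb{E}[\mathcal V(x_{k+1},z_{k+1},\rho)]\le(1-\mu)^{k+1}\,\mathbb{E}[\mathcal V(x_0,z_0,\rho)],$$ $$\mathbb{E}[f(x_{k+1},z_{k+1},\rho)]\le\frac{\eta}{2}(1-\mu)^{k+1}\,\mathbb{E}[\mathcal V(x_0,z_0,\rho)].$$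
   Context: Let $A\in\mathbb{R}^{m\times n}$ and $b\in\mathbb{R}^m$ be such that the linear system $Ax=b$ is consistent. Let $B\in\mathbb{R}^{n\times n}$ and $G\in\mathbb{R}^{p\times p}$ be symmetric positive definite. For a symmetric positive semidefinite matrix $M$ write $\|x\|_M^2=x^\top Mx$. $\lambda_{\max}$ and $\lambda_{\min}^+$ denote the largest and the smallest nonzero eigenvalue of a symmetric positive semidefinite matrix. $\mathcal D$ is a probability distribution on real $m\times p$ matrices and $\mathbb{E}_{\mathcal D}$ is expectation over $S\sim\mathcal D$ (all expectations used are assumed to exist). For $S\sim\mathcal D$ and $\rho>0$ define $$H=\Big(\tfrac1\rho G+S^\top AB^{-1}A^\top S\Big)^{-1},\quad Z=A^\top SHS^\top A,\quad F=\Big(\tfrac1\rho B+A^\top SG^{-1}S^\top A\Big)^{-1},\quad W=S^\top AFA^\top S.$$ Standing assumption on $\mathcal D$: $\mathrm{Null}(\mathbb{E}_{\mathcal D}[SHS^\top])\subseteq\mathrm{Null}(A^\top)$ and $\mathbb{E}_{\mathcal D}[W]\succ0$. ALS method with fixed penalty $\rho$: given $x_0\in\mathbb{R}^n$, $z_0\in\mathbb{R}^p$, at each iteration $k\ge0$ draw a fresh independent sample $S\sim\mathcal D$ and set $$z_{k+1}=\Big(\tfrac1\rho G+S^\top AB^{-1}A^\top S\Big)^{-1}\Big[S^\top Ax_k-S^\top b+\tfrac1\rho Gz_k\Big],\qquad x_{k+1}=x_k-B^{-1}A^\top Sz_{k+1}.$$ $\mathbb{E}$ denotes total expectation. $x^*=\arg\min\{\|x-x_0\|_B^2: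 Ax=b\}=x_0-B^{-1}A^\top(AB^{-1}A^\top)^\dagger(Ax_0-b)$. Functions: $\mathcal V(x,z,\rho)=\|x-x^*\|_B^2+\frac1\rho\|z\|_G^2$ and $f(x,z,\rho)=\mathbb{E}_{\mathcal D}\big[\tfrac12\|x-x^*\|_Z^2+\tfrac1{2\rho}\|z\|_W^2\big]=\tfrac12\|x-x^*\|^2_{\mathbb{E}_{\mathcal D}[Z]}+\tfrac1{2\rho}\|z\|^2_{\mathbb{E}_{\mathcal D}[W]}$. *)

(* Defs.v *)
From mathcomp Require Export all_boot all_order all_algebra.
From mathcomp Require Export finmap.
From mathcomp Require Export all_classical all_reals all_analysis.
From mathcomp Require Export sesquilinear.

Set Implicit Arguments.
Unset Strict Implicit.
Unset Printing Implicit Defensive.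

Import Order.TTheory GRing.Theory Num.Theory.
Import numFieldNormedType.Exports.

Local Open Scope classical_set_scope.
Local Open Scope ring_scope.

Section matrices.
Context {R : realType}.

(* x^T M x, i.e. ||x||_M^2 *)
Definition sqnorm_mx n (M : 'M[R]_n) (x : 'cV[R]_n) : R :=
  (x^T *m M *m x) 0 0.

Definition spd_mx n (M : 'M[R]_n) : Prop :=
  M \is symmetricmx /\ forall x : 'cV[R]_n, x != 0 -> 0 < sqnorm_mx M x.

Definition spsd_mx n (M : 'M[R]_n) : Prop :=
  M \is symmetricmx /\ forall x : 'cV[R]_n, 0 <= sqnorm_mx M x.

(* The symmetric positive semidefinite square root; it exists and is unique
   for every symmetric positive semidefinite M (0 is a junk value). *)
Definition sqrt_mx n (M : 'M[R]_n) : 'M[R]_n :=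
  xget 0 [set X : 'M[R]_n | spsd_mx X /\ X *m X = M].

(* M^{-1/2} *)
Definition invsqrt_mx n (M : 'M[R]_n) : 'M[R]_n := invmx (sqrt_mx M).

(* Sets of eigenvalues are finite, so that sup and inf below are attained as
   soon as the set is nonempty. *)
Definition lambda_max n (M : 'M[R]_n) : R := sup [set a : R | eigenvalue M a].

Definition lambda_min_pos n (M : 'M[R]_n) : R :=
  inf [set a : R | eigenvalue M a /\ a != 0].

End matrices.

(* Real m x p matrices with the Borel sigma-algebra. *)
Definition borel_mx (R : realType) (m p : nat) :=
  g_sigma_algebraType (@open 'M[R]_(m, p)).

Section probability.
Context {R : realType}.

Definition mutually_independent d d' (Omega : measurableType d)
    (T : measurableType d') (P : probability Omega R) (I : choiceType)
    (X : I -> Omega -> T) : Prop :=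
  forall (J : {fset I}) (U : I -> set T), (forall j, measurable (U j)) ->
    P (\bigcap_(j in [set` J]) (X j @^-1` U j)) =
    (\prod_(j <- J) P (X j @^-1` U j))%E.

(* Values on measurable sets only: a measure is a function on all sets, with
   unconstrained values outside the sigma-algebra. *)
Definition has_law d d' (Omega : measurableType d) (T : measurableType d')
    (P : probability Omega R) (X : {mfun Omega >-> T})
    (D : probability T R) : Prop :=
  forall U : set T, measurable U -> distribution P X U = D U.

Context {m p : nat}.
Variable D : probability (borel_mx R m p) R.

Definition integrable_mx q r (X : 'M[R]_(m, p) -> 'M[R]_(q, r)) : Prop :=
  forall i j, D.-integrable setT (fun S : borel_mx R m p => (X S i j)%:E).

Definition expectation_mx q r (X : 'M[R]_(m, p) -> 'M[R]_(q, r)) :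
    'M[R]_(q, r) :=
  \matrix_(i, j) fine 'E_D[fun S : borel_mx R m p => X S i j].

End probability.

Section als.
Context {R : realType} {m n p : nat}.
Variables (A : 'M[R]_(m, n)) (b : 'cV[R]_m) (B : 'M[R]_n) (G : 'M[R]_p).
Variable rho : R.

Definition als_H (S : 'M[R]_(m, p)) : 'M[R]_p :=
  invmx (rho^-1 *: G + S^T *m A *m invmx B *m A^T *m S).

Definition als_Z (S : 'M[R]_(m, p)) : 'M[R]_n :=
  A^T *m S *m als_H S *m S^T *m A.

Definition als_F (S : 'M[R]_(m, p)) : 'M[R]_n :=
  invmx (rho^-1 *: B + A^T *m S *m invmx G *m S^T *m A).

Definition als_W (S : 'M[R]_(m, p)) : 'M[R]_p :=
  S^T *m A *m als_F S *m A^T *m S.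

Definition als_step (S : 'M[R]_(m, p)) (xz : 'cV[R]_n * 'cV[R]_p) :
    'cV[R]_n * 'cV[R]_p :=
  let z := als_H S *m
    (S^T *m A *m xz.1 - S^T *m b + rho^-1 *: (G *m xz.2)) in
  (xz.1 - invmx B *m A^T *m S *m z, z).

(* The pair (x_k, z_k) when sample S j is drawn at iteration j. *)
Fixpoint als_iter (x0 : 'cV[R]_n) (z0 : 'cV[R]_p) (S : nat -> 'M[R]_(m, p))
    (k : nat) : 'cV[R]_n * 'cV[R]_p :=
  if k is j.+1 then als_step (S j) (als_iter x0 z0 S j) else (x0, z0).

(* argmin {||x - x0||_B^2 : A x = b}, which is unique for B positive definite
   and exists as soon as A x = b is consistent (0 is a junk value). *)
Definition B_projection (x0 : 'cV[R]_n) : 'cV[R]_n :=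
  xget 0 [set x : 'cV[R]_n | A *m x = b /\
    forall y : 'cV[R]_n, A *m y = b ->
      sqnorm_mx B (x - x0) <= sqnorm_mx B (y - x0)].

Definition als_V (xs x : 'cV[R]_n) (z : 'cV[R]_p) : R :=
  sqnorm_mx B (x - xs) + rho^-1 * sqnorm_mx G z.

Variable D : probability (borel_mx R m p) R.

Definition als_f (xs x : 'cV[R]_n) (z : 'cV[R]_p) : R :=
  fine 'E_D[fun S : borel_mx R m p =>
    2^-1 * sqnorm_mx (als_Z S) (x - xs) +
    (2 * rho)^-1 * sqnorm_mx (als_W S) z].

Definition als_EZ : 'M[R]_n := expectation_mx D
  (fun S => invsqrt_mx B *m als_Z S *m invsqrt_mx B).

Definition als_EW : 'M[R]_p := expectation_mx D
  (fun S => invsqrt_mx G *m als_W S *m invsqrt_mx G).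

Definition als_mu : R :=
  Num.min (lambda_min_pos als_EZ) (lambda_min_pos als_EW).

Definition als_eta : R := Num.max (lambda_max als_EZ) (lambda_max als_EW).

End als.

(* Main.v *)
(* One step of the method satisfies the exact identity
     V(x', z') = V(x, z) - ||x - x*||_Z^2 - rho^-1 ||z||_W^2,
   in which the term in z comes from the Woodbury identity
   G H G = rho (G - W). Averaging over the fresh sample replaces Z and W by
   their expectations. All the errors x_k - x* lie in the range of
   B^-1 A^T, which is B-orthogonal to Null(A), hence to Null(E[Z]); on this
   space ||.||_{E[Z]}^2 >= lambda_min^+ ||.||_B^2, so E[V] contracts by the
   factor 1 - mu at each step. The bound on f is f <= (eta / 2) V.

   The spectral facts are read off polynomials: a symmetric matrix M is
   annihilated by a product of distinct X - a with a real, so if a polynomial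
   P is nonnegative on the eigenvalues of M, then P(M) = Q(M)^2 for the
   polynomial Q interpolating the square roots of the values of P. Taking
   P = X, lambda_max - X and X^3 - lambda_min^+ X^2 gives the square root
   and the two extremal inequalities. *)
Require Import Defs.
From HB Require Import structures.
From mathcomp Require Import measurable_realfun spectral complex ring lra.

Set Implicit Arguments.
Unset Strict Implicit.
Unset Printing Implicit Defensive.

Import Order.TTheory GRing.Theory Num.Theory.
Import numFieldNormedType.Exports.

Local Open Scope classical_set_scope.
Local Open Scope ring_scope.

(** * Symmetric matrices *)

Section symmetric.
Context {R : realType}.
Implicit Types n : nat.

Lemma symmx_trE n (M : 'M[R]_n) : (M \is symmetricmx) <-> (M^T = M).
Proof.
split=> [/is_hermitianmxP|h]; last apply/is_hermitianmxP;
  by rewrite expr0 scale1r map_mx_id // => /esym.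
Qed.

(** Over the complex numbers [M] is Hermitian, so it is conjugate to a diagonal matrix with real
    entries. The minimal polynomial is invariant under conjugation and field extension, and that of
    a diagonal matrix is the product over its distinct entries. *)
Lemma symmx_mxminpoly n (M : 'M[R]_n.+1) : M^T = M ->
  exists2 s : seq R, uniq s & mxminpoly M = \prod_(a <- s) ('X - a%:P).
Proof.
move=> Msym; pose f := real_complex R; pose C := map_mx f M.
have Csym : C \is symmetricmx.
  by apply/is_hermitianmxP; rewrite expr0 scale1r map_mx_id // /C map_trmx Msym.
have Creal : C \is a realmx.
  by apply/mxOverP => i j; rewrite mxE; apply/complex_realP; exists (M i j).
have Cherm := realsym_hermsym Csym Creal.
have /orthomx_spectralP Ceq := hermitian_normalmx Cherm.
have /mxOverP Dreal := hermitian_spectral_diag_real Cherm.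
set P := spectralmx C in Ceq; set D := spectral_diag C in Ceq Dreal.
have Pu : P \in unitmx by exact: spectral_unit.
pose s := undup [seq complex.Re (D 0 i) | i <- enum 'I_n.+1].
exists s; first exact: undup_uniq.
apply: (@map_poly_inj _ _ f); rewrite -mxminpoly_map -/C Ceq.
have -> : invmx P *m diag_mx D *m P = conjmx (invmx P) (diag_mx D).
  by rewrite conjumx ?unitmx_inv// invmxK.
rewrite mxminpoly_uconj ?unitmx_inv// mxminpoly_diag rmorph_prod /=.
have -> : [seq D 0 i | i <- enum 'I_n.+1] =
          [seq f x | x <- [seq complex.Re (D 0 i) | i <- enum 'I_n.+1]].
  by rewrite -[RHS]map_comp; apply: eq_map => i /=; rewrite /f RRe_real.
rewrite (undup_map_inj (fmorph_inj f)) big_map -/s.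
by apply: eq_bigr => a _; rewrite map_polyXsubC.
Qed.

(** Newton interpolation: a new node [a] is met by adding a multiple of [w], which vanishes at the
    old nodes but not at [a]. *)
Lemma poly_interpolation (K : fieldType) (s : seq K) (f : K -> K) : uniq s ->
  exists q : {poly K}, {in s, forall a, q.[a] = f a}.
Proof.
elim: s => [_|a s IHs /= /andP[as_ us]]; first by exists 0.
have [q qf] := IHs us; pose w := \prod_(b <- s) ('X - b%:P).
have wa0 : w.[a] != 0.
  by rewrite -[_ == 0]/(root w a) root_prod_XsubC.
exists (q + ((f a - q.[a]) / w.[a]) *: w) => b.
rewrite inE => /predU1P[->|bs]; rewrite !hornerE.
  by rewrite divfK// addrC subrK.
have /rootP -> : root w b by rewrite root_prod_XsubC.
by rewrite mulr0 addr0 qf.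
Qed.

Lemma trmx_horner_mx n (M : 'M[R]_n.+1) (p : {poly R}) :
  (horner_mx M p)^T = horner_mx M^T p.
Proof.
elim/poly_ind: p => [|p c IH]; first by rewrite !rmorph0 trmx0.
rewrite !rmorphD !rmorphM /= !horner_mx_X !horner_mx_C linearD /= tr_scalar_mx.
congr (_ + _); rewrite -[in LHS]mulmxE trmx_mul IH mulmxE.
by apply: commr_sym; exact: comm_horner_mx.
Qed.

Lemma symmx_horner_sqrt n (M : 'M[R]_n.+1) (p : {poly R}) : M^T = M ->
    (forall a, eigenvalue M a -> 0 <= p.[a]) ->
  exists2 q : {poly R}, (forall a, eigenvalue M a -> 0 <= q.[a]) &
    horner_mx M p = horner_mx M q *m horner_mx M q.
Proof.
move=> Msym p0; have [s us Ms] := symmx_mxminpoly Msym.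
have sP a : eigenvalue M a = (a \in s).
  by rewrite eigenvalue_root_min Ms root_prod_XsubC.
have [q qs] := poly_interpolation (fun a => Num.sqrt p.[a]) us.
exists q => [a|]; first by rewrite sP => /qs ->; exact: sqrtr_ge0.
rewrite mulmxE -rmorphM /=; apply/eqP; rewrite -subr_eq0 -rmorphB /=; apply/eqP.
(* The minimal polynomial is a product of distinct linear factors, so it divides [p - q * q] as soon
   as the latter vanishes at every eigenvalue. *)
apply/mxminpoly_minP; rewrite Ms; apply: uniq_roots_dvdp; last first.
  by rewrite uniq_rootsE.
apply/allP => a sa; rewrite rootE !hornerE qs// -expr2 sqr_sqrtr ?subrr// p0//.
by rewrite sP.
Qed.

Lemma sqnorm_mx1E n (v : 'cV[R]_n) : sqnorm_mx 1%:M v = \sum_i v i 0 ^+ 2.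
Proof.
by rewrite /sqnorm_mx mulmx1 mxE; apply: eq_bigr => i _; rewrite mxE expr2.
Qed.

Lemma sqnorm_mx1_ge0 n (v : 'cV[R]_n) : 0 <= sqnorm_mx 1%:M v.
Proof. by rewrite sqnorm_mx1E sumr_ge0// => i _; exact: sqr_ge0. Qed.

Lemma sqnorm_mx1_eq0 n (v : 'cV[R]_n) : (sqnorm_mx 1%:M v == 0) = (v == 0).
Proof.
rewrite sqnorm_mx1E psumr_eq0; last by move=> i _; exact: sqr_ge0.
apply/allP/eqP => [h|-> i _]; last by rewrite /= mxE expr0n /= eqxx.
apply/matrixP => i j; rewrite ord1 mxE; apply/eqP.
by have := h i (mem_index_enum _); rewrite sqrf_eq0.
Qed.

Lemma sqnorm_mx1_gt0 n (v : 'cV[R]_n) : v != 0 -> 0 < sqnorm_mx 1%:M v.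
Proof.
by move=> v0; rewrite lt_neqAle eq_sym sqnorm_mx1_eq0 v0 sqnorm_mx1_ge0.
Qed.

Lemma sqnorm_mxM n k (M : 'M[R]_k) (N : 'M[R]_(k, n)) (v : 'cV[R]_n) :
  sqnorm_mx M (N *m v) = sqnorm_mx (N^T *m M *m N) v.
Proof. by rewrite /sqnorm_mx trmx_mul !mulmxA. Qed.

Lemma sqnorm_mxD n (M N : 'M[R]_n) (v : 'cV[R]_n) :
  sqnorm_mx (M + N) v = sqnorm_mx M v + sqnorm_mx N v.
Proof. by rewrite /sqnorm_mx mulmxDr mulmxDl mxE. Qed.

Lemma sqnorm_mxN n (M : 'M[R]_n) (v : 'cV[R]_n) :
  sqnorm_mx (- M) v = - sqnorm_mx M v.
Proof. by rewrite /sqnorm_mx mulmxN mulNmx mxE. Qed.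

Lemma sqnorm_mxZ n a (M : 'M[R]_n) (v : 'cV[R]_n) :
  sqnorm_mx (a *: M) v = a * sqnorm_mx M v.
Proof. by rewrite /sqnorm_mx -scalemxAr -scalemxAl mxE. Qed.

Lemma sqnorm_mx0 n (M : 'M[R]_n) : sqnorm_mx M 0 = 0.
Proof. by rewrite /sqnorm_mx mulmx0 mxE. Qed.

Lemma sqnorm_horner_ge0 n (M : 'M[R]_n.+1) (p : {poly R}) v : M^T = M ->
    (forall a, eigenvalue M a -> 0 <= p.[a]) ->
  0 <= sqnorm_mx (horner_mx M p) v.
Proof.
move=> Msym /(symmx_horner_sqrt Msym)[q _ ->].
rewrite -{1}Msym -trmx_horner_mx -[_^T]mulmx1 -sqnorm_mxM.
exact: sqnorm_mx1_ge0.
Qed.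

Lemma spsd_horner n (M : 'M[R]_n.+1) (p : {poly R}) : M^T = M ->
  (forall a, eigenvalue M a -> 0 <= p.[a]) -> spsd_mx (horner_mx M p).
Proof.
move=> Msym p0; split; last by move=> v; exact: sqnorm_horner_ge0.
by apply/symmx_trE; rewrite trmx_horner_mx Msym.
Qed.

Lemma symmx_eigenvectorP n (M : 'M[R]_n) a : M^T = M ->
  eigenvalue M a -> exists2 v : 'cV[R]_n, v != 0 & M *m v = a *: v.
Proof.
move=> Msym /eigenvalueP[u uM u0]; exists u^T.
  by rewrite -(inj_eq trmx_inj) trmxK trmx0.
by rewrite -{1}Msym -trmx_mul uM linearZ.
Qed.

Lemma sqnorm_eigenvector n (M : 'M[R]_n) a v : M *m v = a *: v ->
  sqnorm_mx M v = a * sqnorm_mx 1%:M v.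
Proof. by rewrite /sqnorm_mx -mulmxA mulmx1 => ->; rewrite -scalemxAr mxE. Qed.

Lemma spsd_eigenvalue_ge0 n (M : 'M[R]_n) a : spsd_mx M ->
  eigenvalue M a -> 0 <= a.
Proof.
move=> [/symmx_trE Msym M0].
move=> /(symmx_eigenvectorP Msym)[v v0 /sqnorm_eigenvector Mv].
by have := M0 v; rewrite Mv pmulr_lge0// sqnorm_mx1_gt0.
Qed.

Lemma eigenvalues_finite n (M : 'M[R]_n.+1) : M^T = M ->
  exists s : seq R, forall a, eigenvalue M a = (a \in s).
Proof.
move=> /symmx_mxminpoly[s _ Ms]; exists s => a.
by rewrite eigenvalue_root_min Ms root_prod_XsubC.
Qed.

Lemma eigenvalue_le_lambda_max n (M : 'M[R]_n.+1) a : M^T = M ->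
  eigenvalue M a -> a <= lambda_max M.
Proof.
move=> /eigenvalues_finite[s sP] Ma; apply: ub_le_sup => //.
(* Any upper bound of the finite list makes [sup] meaningful; the sum of absolute values is one. *)
exists (\sum_(b <- s) `|b|) => b /=; rewrite sP => bs.
apply: (le_trans (ler_norm b)).
by rewrite (big_rem b bs) /= lerDl sumr_ge0.
Qed.

Lemma sqnorm_le_lambda_max n (M : 'M[R]_n.+1) v : M^T = M ->
  sqnorm_mx M v <= lambda_max M * sqnorm_mx 1%:M v.
Proof.
move=> Msym; rewrite -subr_ge0 -sqnorm_mxZ -sqnorm_mxN -sqnorm_mxD.
have -> : lambda_max M *: 1%:M - M = horner_mx M ((lambda_max M)%:P - 'X).
  by rewrite rmorphB /= horner_mx_C horner_mx_X scalemx1.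
apply: sqnorm_horner_ge0 => // a Ma; rewrite !hornerE subr_ge0.
exact: eigenvalue_le_lambda_max.
Qed.

(** If no eigenvalue other than 0 exists, [- 'X ^+ 2] is nonnegative on the spectrum, so [- M ^+ 2]
    is positive semidefinite. Its form at [v] is minus the squared length of [M *m v], so [M] kills
    every basis vector. *)
Lemma spsd_exists_eigenvalue n (M : 'M[R]_n.+1) : spsd_mx M -> M != 0 ->
  exists2 a, eigenvalue M a & a != 0.
Proof.
move=> [/symmx_trE Msym M0]; apply: contra_neqP => noM.
have M2 v : 0 <= sqnorm_mx (horner_mx M (- 'X ^+ 2)) v.
  apply: sqnorm_horner_ge0 => // a Ma; have [->|a0] := eqVneq a 0.
    by rewrite !hornerE expr0n oppr0.
  by case: noM; exists a.
apply/matrixP => i j; have := M2 (delta_mx j 0).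
rewrite rmorphN rmorphXn /= horner_mx_X sqnorm_mxN oppr_ge0 expr2 -mulmxE.
rewrite -{1}Msym -[M^T]mulmx1 -sqnorm_mxM => h.
have : sqnorm_mx 1%:M (M *m delta_mx j 0) == 0.
  by rewrite eq_le h sqnorm_mx1_ge0.
rewrite sqnorm_mx1_eq0 => /eqP/matrixP/(_ i 0).
by rewrite -colE !mxE.
Qed.

Lemma seq_min_exists (s : seq R) : s != [::] ->
  exists2 a, a \in s & {in s, forall b, a <= b}.
Proof.
elim: s => // a s IHs _; have [->|/IHs[c cs cP]] := eqVneq s [::].
  by exists a; [rewrite inE|move=> b; rewrite inE => /eqP->].
have [ac|ca] := leP a c.
  exists a; first by rewrite inE eqxx.
  by move=> b; rewrite inE => /predU1P[->//|/cP]; exact: le_trans.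
exists c; first by rewrite inE cs orbT.
by move=> b; rewrite inE => /predU1P[->|/cP//]; exact: ltW.
Qed.

Lemma lambda_min_pos_le n (M : 'M[R]_n.+1) a : spsd_mx M ->
  eigenvalue M a -> a != 0 -> lambda_min_pos M <= a.
Proof.
move=> Mpsd Ma a0; apply: ge_inf => //; exists 0 => b /= [Mb _].
exact: spsd_eigenvalue_ge0 Mb.
Qed.

(** The infimum runs over a finite set of positive numbers, nonempty because [M != 0]; its least
    element [c] bounds the infimum from below. *)
Lemma lambda_min_pos_gt0 n (M : 'M[R]_n.+1) : spsd_mx M -> M != 0 ->
  0 < lambda_min_pos M.
Proof.
move=> Mpsd M0; have [a Ma a0] := spsd_exists_eigenvalue Mpsd M0.
have [/symmx_trE Msym _] := Mpsd; have [s sP] := eigenvalues_finite Msym.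
have as_ : a \in [seq b <- s | b != 0] by rewrite mem_filter a0 -sP.
have [|c] := @seq_min_exists [seq b <- s | b != 0].
  by apply: contraTneq as_ => ->.
rewrite mem_filter -sP => /andP[c0 Mc] cP.
apply: (@lt_le_trans _ _ c).
  by rewrite lt_neqAle eq_sym c0 (spsd_eigenvalue_ge0 Mpsd).
apply: lb_le_inf; first by exists a.
by move=> b /= [Mb b0]; apply: cP; rewrite mem_filter b0 -sP.
Qed.

(* [M^3 - lambda M^2] is positive semidefinite. *)
Lemma lambda_min_pos_le_sqnorm n (M : 'M[R]_n.+1) (u : 'cV[R]_n.+1) :
    spsd_mx M ->
  lambda_min_pos M * sqnorm_mx 1%:M (M *m u) <= sqnorm_mx M (M *m u).
Proof.
move=> Mpsd; have [/symmx_trE Msym _] := Mpsd; set l := lambda_min_pos M.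
rewrite !sqnorm_mxM Msym mulmx1 -subr_ge0 -sqnorm_mxZ -sqnorm_mxN -sqnorm_mxD.
have -> : M *m M *m M - l *: (M *m M) = horner_mx M ('X ^+ 3 - l *: 'X ^+ 2).
  rewrite rmorphB /= horner_mxZ !rmorphXn /= horner_mx_X !exprS expr0 mulr1.
  by rewrite !mulmxE mulrA.
apply: sqnorm_horner_ge0 => // a Ma.
have -> : ('X ^+ 3 - l *: 'X ^+ 2).[a] = (a - l) * a ^+ 2.
  by rewrite !hornerE /=; ring.
have [->|a0] := eqVneq a 0; first by rewrite expr0n mulr0.
by rewrite mulr_ge0 ?sqr_ge0// subr_ge0 lambda_min_pos_le.
Qed.

(** The range of a symmetric matrix is the orthogonal complement of its kernel. It is enough to test
    [v] against the columns of [cokermx M], which lie in that kernel. *)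
Lemma symmx_range n (M : 'M[R]_n) (v : 'cV[R]_n) : M^T = M ->
    (forall u : 'cV[R]_n, M *m u = 0 -> (v^T *m u) 0 0 = 0) ->
  exists u, v = M *m u.
Proof.
move=> Msym vM; suff /submxP[u vu] : (v^T <= M)%MS.
  by exists u^T; rewrite -[v]trmxK vu trmx_mul Msym.
rewrite submxE; apply/eqP/matrixP => i j; rewrite ord1 [RHS]mxE.
rewrite -[RHS](vM (col j (cokermx M))); last first.
  by rewrite colE mulmxA mulmx_coker mul0mx.
by rewrite [in RHS]colE [in RHS]mulmxA -[in RHS]colE [RHS]mxE.
Qed.

Lemma sqrt_mxP n (M : 'M[R]_n) : spsd_mx M ->
  spsd_mx (sqrt_mx M) /\ sqrt_mx M *m sqrt_mx M = M.
Proof.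
move=> Mpsd; rewrite /sqrt_mx.
suff : exists X : 'M[R]_n, spsd_mx X /\ X *m X = M by exact: xgetPex.
(* Polynomials in a matrix require a nonzero dimension; in dimension 0 all matrices are equal. *)
case: n M Mpsd => [|n] M Mpsd.
  by exists M; split => //; apply/matrixP => -[].
have [/symmx_trE Msym _] := Mpsd.
have [|q q0 Mq] := symmx_horner_sqrt (p := 'X) Msym.
  by move=> a Ma; rewrite hornerX (spsd_eigenvalue_ge0 Mpsd).
exists (horner_mx M q); split; first exact: spsd_horner.
by rewrite -Mq horner_mx_X.
Qed.

(** With [Q] the square root of [M], the form at [v] is the squared length of [Q *m v]. *)
Lemma spsd_sqnorm_eq0 n (M : 'M[R]_n) (v : 'cV[R]_n) : spsd_mx M ->
  sqnorm_mx M v = 0 -> M *m v = 0.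
Proof.
move=> /sqrt_mxP; set Q := sqrt_mx M => -[[/symmx_trE Qsym _] <-].
rewrite -{1}Qsym -[Q^T]mulmx1 -sqnorm_mxM => /eqP.
by rewrite sqnorm_mx1_eq0 -mulmxA => /eqP->; rewrite mulmx0.
Qed.

Lemma spd_spsd n (M : 'M[R]_n) : spd_mx M -> spsd_mx M.
Proof.
move=> [Msym M0]; split=> // v; have [->|/M0/ltW//] := eqVneq v 0.
by rewrite sqnorm_mx0.
Qed.

Lemma spd_unitmx n (M : 'M[R]_n) : spd_mx M -> M \in unitmx.
Proof.
move=> [_ M0]; rewrite -row_free_unit -kermx_eq0; apply/rowV0P.
move=> u /sub_kermxP uM.
apply/eqP/negP => /negP u0; have /M0 : u^T != 0.
  by rewrite -(inj_eq trmx_inj) trmxK trmx0.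
by rewrite /sqnorm_mx trmxK uM mul0mx mxE ltxx.
Qed.

Lemma spd_inv n (M : 'M[R]_n) : spd_mx M -> spd_mx (invmx M).
Proof.
move=> Mspd; have Mu := spd_unitmx Mspd; have [/symmx_trE Msym M0] := Mspd.
have Isym : (invmx M)^T = invmx M by rewrite trmx_inv Msym.
split=> [|v v0]; first exact/symmx_trE.
have -> : sqnorm_mx (invmx M) v = sqnorm_mx M (invmx M *m v).
  by rewrite sqnorm_mxM Isym mulVmx// mul1mx.
apply: M0; apply: contra_neq v0 => h.
by rewrite -[v](mulKVmx Mu) h mulmx0.
Qed.

Lemma spsd_congr n k (M : 'M[R]_k) (N : 'M[R]_(k, n)) :
  spsd_mx M -> spsd_mx (N^T *m M *m N).
Proof.
move=> [/symmx_trE Msym M0]; split; last by move=> v; rewrite -sqnorm_mxM.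
by apply/symmx_trE; rewrite !trmx_mul trmxK Msym mulmxA.
Qed.

Lemma spd_addZ n (M N : 'M[R]_n) a : 0 < a -> spd_mx M -> spsd_mx N ->
  spd_mx (a *: M + N).
Proof.
move=> a0 [/symmx_trE Msym M0] [/symmx_trE Nsym N0]; split.
  by apply/symmx_trE; rewrite linearD linearZ /= Msym Nsym.
by move=> v v0; rewrite sqnorm_mxD sqnorm_mxZ ltr_wpDr// mulr_gt0// M0.
Qed.

(** * Comparison of a semidefinite form with a positive definite one *)

Section invsqrt.
Variables (n : nat) (B E : 'M[R]_n.+1).
Hypotheses (hB : spd_mx B) (hE : spsd_mx E).
Let Q := sqrt_mx B.

Let QQ : Q *m Q = B. Proof. exact: (sqrt_mxP (spd_spsd hB)).2. Qed.

Let Qsym : Q^T = Q.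
Proof. by have [[/symmx_trE]] := sqrt_mxP (spd_spsd hB). Qed.

Let Qu : Q \in unitmx.
Proof.
by have := spd_unitmx hB; rewrite -QQ unitmx_mul => /andP[].
Qed.

Let Ehat := invsqrt_mx B *m E *m invsqrt_mx B.

Let invQsym : (invsqrt_mx B)^T = invsqrt_mx B.
Proof. by rewrite /invsqrt_mx -/Q trmx_inv Qsym. Qed.

(** The substitution of [Q *m e] for [e] turns the form of [B] into the Euclidean one and, below,
    that of [E] into that of [Ehat]; the spectrum of [Ehat] thus compares [E] with [B]. *)
Let sqnormB e : sqnorm_mx B e = sqnorm_mx 1%:M (Q *m e).
Proof. by rewrite sqnorm_mxM Qsym mulmx1 QQ. Qed.

Let sqnormE e : sqnorm_mx E e = sqnorm_mx Ehat (Q *m e).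
Proof.
rewrite sqnorm_mxM Qsym /Ehat /invsqrt_mx -/Q !mulmxA mulmxV// mul1mx.
by rewrite -mulmxA mulVmx// mulmx1.
Qed.

Lemma spsd_invsqrt : spsd_mx Ehat.
Proof. by rewrite /Ehat -{1}invQsym; exact: spsd_congr. Qed.

Let Ehat_eq0 : E != 0 -> Ehat != 0.
Proof.
apply: contra_neq => h; rewrite -[E](mulKVmx Qu) -[invmx Q *m E](mulmxKV Qu).
by rewrite -/(invsqrt_mx B) -/Ehat h mul0mx mulmx0.
Qed.

Lemma lambda_max_invsqrt e :
  sqnorm_mx E e <= lambda_max Ehat * sqnorm_mx B e.
Proof.
rewrite sqnormE sqnormB; apply: sqnorm_le_lambda_max.
by have [/symmx_trE] := spsd_invsqrt.
Qed.

Lemma lambda_max_invsqrt_ge0 : E != 0 -> 0 <= lambda_max Ehat.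
Proof.
move=> /Ehat_eq0 /(spsd_exists_eigenvalue spsd_invsqrt)[a Ea _].
apply: le_trans (eigenvalue_le_lambda_max _ Ea).
  exact: spsd_eigenvalue_ge0 spsd_invsqrt Ea.
by have [/symmx_trE] := spsd_invsqrt.
Qed.

Lemma lambda_min_pos_invsqrt_gt0 : E != 0 -> 0 < lambda_min_pos Ehat.
Proof. by move=> /Ehat_eq0; exact: lambda_min_pos_gt0 spsd_invsqrt. Qed.

(** Testing the domination of [E] by [B] at [invmx Q *m v], for [v] an eigenvector of [Ehat] with
    nonzero eigenvalue [a], gives [a <= 1]. *)
Lemma lambda_min_pos_invsqrt_le1 : E != 0 ->
  (forall e, sqnorm_mx E e <= sqnorm_mx B e) -> lambda_min_pos Ehat <= 1.
Proof.
move=> /Ehat_eq0 /(spsd_exists_eigenvalue spsd_invsqrt)[a Ea a0] EB.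
have [/symmx_trE Esym _] := spsd_invsqrt.
apply: le_trans (lambda_min_pos_le spsd_invsqrt Ea a0) _.
have [v v0 /sqnorm_eigenvector Ev] := symmx_eigenvectorP Esym Ea.
have := EB (invmx Q *m v); rewrite sqnormE sqnormB mulKVmx// Ev.
by rewrite ger_pMl// sqnorm_mx1_gt0.
Qed.

(** The vectors [invmx B *m C^T *m y] are [B]-orthogonal to the kernel of [C], hence to that of [E].
    Their images under [Q] are then orthogonal to the kernel of [Ehat], so they lie in its range,
    where the bound by the least nonzero eigenvalue holds. *)
Lemma lambda_min_pos_invsqrt k (C : 'M[R]_(k, n.+1)) y :
    (forall v : 'cV[R]_n.+1, E *m v = 0 -> C *m v = 0) ->
  lambda_min_pos Ehat * sqnorm_mx B (invmx B *m C^T *m y) <=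
    sqnorm_mx E (invmx B *m C^T *m y).
Proof.
move=> EC; rewrite sqnormE sqnormB; have [/symmx_trE Esym _] := spsd_invsqrt.
have [u|u ->] := @symmx_range _ Ehat (Q *m (invmx B *m C^T *m y)) Esym;
  last exact: lambda_min_pos_le_sqnorm spsd_invsqrt.
(* If [Ehat *m u = 0], then [E], and so [C], kills [invmx Q *m u]; the scalar product with [u]
   becomes [y^T *m C *m invmx Q *m u]. *)
rewrite /Ehat -!mulmxA => /(congr1 (mulmx Q)).
rewrite mulmx0 mulKVmx// => /EC Cu.
have [/symmx_trE Bsym _] := hB; have Bu := spd_unitmx hB.
rewrite !trmx_mul trmxK Qsym trmx_inv Bsym -!mulmxA -[u](mulKVmx Qu).
by rewrite [Q *m (Q *m _)]mulmxA QQ mulKmx// Cu mulmx0 mxE.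
Qed.

End invsqrt.

End symmetric.

(** * Algebra of one step *)

Section als_algebra.
Context {R : realType}.

Lemma mx11_trC n (u v : 'cV[R]_n) : (u^T *m v) 0 0 = (v^T *m u) 0 0.
Proof. by rewrite -[u^T *m v]trmxK trmx_mul trmxK mxE. Qed.

Lemma sqnorm_mxNv n (M : 'M[R]_n) (v : 'cV[R]_n) :
  sqnorm_mx M (- v) = sqnorm_mx M v.
Proof. by rewrite /sqnorm_mx [(- v)^T]linearN /= mulmxN !mulNmx opprK. Qed.

Lemma sqnorm_mxBv n (M : 'M[R]_n) (u v : 'cV[R]_n) : M^T = M ->
  sqnorm_mx M (u - v) =
  sqnorm_mx M u - 2 * (v^T *m (M *m u)) 0 0 + sqnorm_mx M v.
Proof.
move=> Msym; rewrite /sqnorm_mx [(u - v)^T]linearB /= !mulmxBr !mulmxBl.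
have subE (x y : 'M[R]_1) : (x - y) 0 0 = x 0 0 - y 0 0 by rewrite !mxE.
rewrite !subE.
have -> : (u^T *m M *m v) 0 0 = (v^T *m (M *m u)) 0 0.
  by rewrite -mulmxA mx11_trC trmx_mul Msym mulmxA.
by rewrite !mulmxA; ring.
Qed.

(** The minimiser is built as [xt], the solution with [x0 - xt] in the range of [invmx B *m A^T];
    Pythagoras makes it the only one. The second conclusion is what later confines all errors to
    that range. *)
Lemma B_projectionP m n (A : 'M[R]_(m, n)) b (B : 'M[R]_n) x0 :
    spd_mx B -> (exists x, A *m x = b) ->
  A *m B_projection A b B x0 = b /\
  exists y, x0 - B_projection A b B x0 = invmx B *m A^T *m y.
Proof.
move=> hB [x Axb]; have Bu := spd_unitmx hB; have [/symmx_trE Bsym _] := hB.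
have iB := spd_inv hB; have [/symmx_trE iBsym iB0] := iB.
pose K := A *m invmx B *m A^T.
have Ksym : K^T = K by rewrite /K !trmx_mul trmxK iBsym mulmxA.
(* The equation for [y] is solvable: [K *m u = 0] forces [A^T *m u = 0], because [invmx B] is
   positive definite. *)
have [u Ku|y Ky] := @symmx_range _ _ K (A *m (x0 - x)) Ksym.
  suff Au : A^T *m u = 0 by rewrite trmx_mul -mulmxA Au mulmx0 mxE.
  apply/eqP/negPn/negP => /iB0; rewrite sqnorm_mxM trmxK -/K /sqnorm_mx.
  by rewrite -mulmxA Ku mulmx0 mxE ltxx.
have [xt xtE] : exists xt, x0 - xt = invmx B *m A^T *m y.
  by exists (x0 - invmx B *m A^T *m y); rewrite opprB addrC subrK.
have Axt : A *m xt = b.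
  apply/eqP; rewrite -subr_eq0 -oppr_eq0 opprB -Axb -mulmxBr.
  have -> : x - xt = (x0 - xt) - (x0 - x).
    by rewrite opprB [RHS]addrC addrA subrK.
  by rewrite mulmxBr xtE !mulmxA -/K -Ky subrr.
(* Here [z - xt] is in the kernel of [A], which is [B]-orthogonal to [x0 - xt]. *)
have pyth z : A *m z = b ->
    sqnorm_mx B (z - x0) = sqnorm_mx B (z - xt) + sqnorm_mx B (xt - x0).
  move=> Azb; have -> : z - x0 = (z - xt) - (x0 - xt).
    by rewrite opprB addrA subrK.
  rewrite sqnorm_mxBv// -[xt - x0]opprB [sqnorm_mx B (- _)]sqnorm_mxNv.
  suff -> : (x0 - xt)^T *m (B *m (z - xt)) = 0 by rewrite mxE mulr0 subr0.
  rewrite xtE !trmx_mul trmxK iBsym !mulmxA mulmxKV// -mulmxA mulmxBr.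
  by rewrite Azb Axt subrr mulmx0.
pose T := [set x : 'cV[R]_n | A *m x = b /\
    forall y : 'cV[R]_n, A *m y = b ->
      sqnorm_mx B (x - x0) <= sqnorm_mx B (y - x0)].
have Txt : T xt.
  split=> // z Azb; rewrite (pyth z)// lerDr; exact: (spd_spsd hB).2.
have [AP minP] : T (B_projection A b B x0) by apply: xgetPex; exists xt.
split=> //; exists y.
suff -> : B_projection A b B x0 = xt by [].
(* Minimality compared with [xt] leaves no room for the extra Pythagorean term. *)
have := minP _ Axt; rewrite (pyth _ AP) gerDr => le0.
apply/eqP; rewrite -subr_eq0; apply/negPn/negP => /hB.2.
by rewrite ltNge le0.
Qed.

(** An explicit candidate [X] for the inverse of [K] is checked by [K *m X = 1%:M], then multiplied
    by [G] on both sides. *)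
Lemma woodbury n p (B : 'M[R]_n) (G : 'M[R]_p) (M : 'M[R]_(n, p)) (c : R) :
    c != 0 -> B \in unitmx -> G \in unitmx ->
    c^-1 *: G + M^T *m invmx B *m M \in unitmx ->
    c^-1 *: B + M *m invmx G *m M^T \in unitmx ->
  G *m invmx (c^-1 *: G + M^T *m invmx B *m M) *m G =
  c *: (G - M^T *m invmx (c^-1 *: B + M *m invmx G *m M^T) *m M).
Proof.
move=> c0 Bu Gu; set K := (X in X \in _ -> _) => Ku Lu.
have := mulmxV Lu; set F := invmx (_ + M *m _ *m _).
(* [PF] is the defining equation of [F] solved for [M *m invmx G *m M^T *m F]; it removes the
   product that is quadratic in [M *m invmx G *m M^T] from [K *m X]. *)
rewrite mulmxDl -scalemxAl => /eqP; rewrite addrC eq_sym -subr_eq => /eqP PF.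
have [W WE] : exists W, W = M^T *m F *m M by exists (M^T *m F *m M).
have MW : M^T *m invmx B *m M *m invmx G *m W *m invmx G =
    M^T *m invmx B *m M *m invmx G - c^-1 *: (W *m invmx G).
  have -> : M^T *m invmx B *m M *m invmx G *m W *m invmx G =
      M^T *m invmx B *m (M *m invmx G *m M^T *m F) *m (M *m invmx G).
    by rewrite WE !mulmxA.
  rewrite -PF mulmxBr mulmx1 mulmxBl -scalemxAr -scalemxAl !mulmxA.
  by rewrite mulmxKV// WE.
pose X := c *: (invmx G - invmx G *m W *m invmx G).
have KX : K *m X = 1%:M.
  rewrite /X -scalemxAr /K mulmxDl !mulmxBr -!scalemxAl !mulmxA mulmxV// mul1mx.
  by rewrite MW subKr subrK scalerA divff// scale1r.
have -> : invmx K = X by rewrite -[X](mulKmx Ku) KX mulmx1.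
rewrite -WE /X -scalemxAr -scalemxAl mulmxBr mulmxBl mulmxV// mul1mx.
by rewrite !mulmxA mulmxV// mul1mx mulmxKV.
Qed.

Variables (m n p : nat) (A : 'M[R]_(m, n)) (b : 'cV[R]_m).
Variables (B : 'M[R]_n) (G : 'M[R]_p) (rho : R).
Hypotheses (hB : spd_mx B) (hG : spd_mx G) (hrho : 0 < rho).
Implicit Type S : 'M[R]_(m, p).

Let Bsym : B^T = B. Proof. by case: hB => /symmx_trE. Qed.
Let Gsym : G^T = G. Proof. by case: hG => /symmx_trE. Qed.
Let iBsym : (invmx B)^T = invmx B. Proof. by rewrite trmx_inv Bsym. Qed.
Let Bu : B \in unitmx. Proof. exact: spd_unitmx. Qed.
Let Gu : G \in unitmx. Proof. exact: spd_unitmx. Qed.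

Lemma als_invH_spd S :
  spd_mx (rho^-1 *: G + S^T *m A *m invmx B *m A^T *m S).
Proof.
apply: spd_addZ; [by rewrite invr_gt0|by []|].
have -> : S^T *m A *m invmx B *m A^T *m S =
    (A^T *m S)^T *m invmx B *m (A^T *m S).
  by rewrite trmx_mul trmxK !mulmxA.
exact/spsd_congr/spd_spsd/spd_inv.
Qed.

Lemma als_invF_spd S :
  spd_mx (rho^-1 *: B + A^T *m S *m invmx G *m S^T *m A).
Proof.
apply: spd_addZ; [by rewrite invr_gt0|by []|].
have -> : A^T *m S *m invmx G *m S^T *m A =
    (S^T *m A)^T *m invmx G *m (S^T *m A).
  by rewrite trmx_mul trmxK !mulmxA.
exact/spsd_congr/spd_spsd/spd_inv.
Qed.

Lemma als_H_spd S : spd_mx (als_H A B G rho S).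
Proof. exact/spd_inv/als_invH_spd. Qed.

Lemma als_ZE S : als_Z A B G rho S =
  (S^T *m A)^T *m als_H A B G rho S *m (S^T *m A).
Proof. by rewrite trmx_mul trmxK !mulmxA. Qed.

Lemma als_Z_spsd S : spsd_mx (als_Z A B G rho S).
Proof. by rewrite als_ZE; exact/spsd_congr/spd_spsd/als_H_spd. Qed.

Lemma als_HW S :
  G *m als_H A B G rho S *m G = rho *: (G - als_W A B G rho S).
Proof.
have rho0 : rho != 0 by rewrite gt_eqF.
have := woodbury rho0 Bu Gu (M := A^T *m S).
rewrite !trmx_mul trmxK !mulmxA => -> //; apply: spd_unitmx.
- exact: als_invH_spd.
- exact: als_invF_spd.
Qed.

(** The step feeds [rho^-1 *: (G *m z)] to [H]; the form of [H] there carries the whole decrease in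
    [z]. *)
Lemma sqnorm_als_H S z :
  sqnorm_mx (als_H A B G rho S) (rho^-1 *: (G *m z)) =
  rho^-1 * (sqnorm_mx G z - sqnorm_mx (als_W A B G rho S) z).
Proof.
rewrite scalemxAl sqnorm_mxM [(rho^-1 *: G)^T]linearZ /= Gsym.
rewrite -!scalemxAl -scalemxAr als_HW.
rewrite !scalerA sqnorm_mxZ sqnorm_mxD sqnorm_mxN.
by rewrite divfK ?gt_eqF.
Qed.

(** With [z' = H *m (c + g)], the new value of [V] is the squared [B]-norm of [e] minus [2 z'^T c]
    plus [z'^T (c + g)]. Since [z'^T (g - c) = g^T H g - c^T H c], the cross terms cancel; the two
    remaining forms give the terms in [W] and [Z]. *)
Lemma als_V_step S xs x z : A *m xs = b ->
  als_V B G rho xs (als_step A b B G rho S (x, z)).1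
                   (als_step A b B G rho S (x, z)).2 =
  als_V B G rho xs x z - sqnorm_mx (als_Z A B G rho S) (x - xs)
                       - rho^-1 * sqnorm_mx (als_W A B G rho S) z.
Proof.
move=> Axs; rewrite /als_step /=.
set H := als_H A B G rho S; set e := x - xs.
pose c := S^T *m A *m e; pose g := rho^-1 *: (G *m z).
have -> : S^T *m A *m x - S^T *m b + rho^-1 *: (G *m z) = c + g.
  by rewrite /c /g /e mulmxBr -!mulmxA Axs.
set z' := H *m (c + g); rewrite /als_V addrAC -/e.
have [/symmx_trE Hsym _] := als_H_spd S.
have Kz' : (rho^-1 *: G + S^T *m A *m invmx B *m A^T *m S) *m z' = c + g.
  by rewrite /z' mulKVmx//; exact/spd_unitmx/als_invH_spd.
(* Both quadratic terms in [z'] add up to the form of the inverse of [H], which sends [z'] to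
   [c + g]. *)
have normz' : rho^-1 * sqnorm_mx G z' +
    sqnorm_mx B (invmx B *m A^T *m S *m z') = (z'^T *m (c + g)) 0 0.
  rewrite -Kz' [sqnorm_mx B _]sqnorm_mxM -sqnorm_mxZ -sqnorm_mxD.
  rewrite /sqnorm_mx -mulmxA.
  congr ((_ *m ((_ + _) *m _)) _ _).
  by rewrite !trmx_mul trmxK iBsym !mulmxA mulmxKV.
have Bc : (invmx B *m A^T *m S *m z')^T *m (B *m e) = z'^T *m c.
  by rewrite /c !trmx_mul trmxK iBsym !mulmxA mulmxKV.
rewrite sqnorm_mxBv// Bc -addrA [_ + rho^-1 * _]addrC normz'.
have Zc : sqnorm_mx (als_Z A B G rho S) e = (c^T *m H *m c) 0 0.
  by rewrite als_ZE -sqnorm_mxM.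
have := sqnorm_als_H S z; rewrite -/H -/g {1}/sqnorm_mx => Hg.
have z'T : z'^T = c^T *m H + g^T *m H.
  by rewrite /z' trmx_mul Hsym linearD /= mulmxDl.
have sw : (c^T *m H *m g) 0 0 = (g^T *m H *m c) 0 0.
  by rewrite -mulmxA mx11_trC trmx_mul Hsym.
have -> : (z'^T *m (c + g)) 0 0 = (c^T *m H *m c) 0 0 + (g^T *m H *m c) 0 0
    + (c^T *m H *m g) 0 0 + (g^T *m H *m g) 0 0.
  by rewrite z'T mulmxDr !mulmxDl !mxE; ring.
have -> : (z'^T *m c) 0 0 = (c^T *m H *m c) 0 0 + (g^T *m H *m c) 0 0.
  by rewrite z'T mulmxDl mxE.
by rewrite sw Hg Zc; ring.
Qed.

Lemma als_V_ge0 xs x z : 0 <= als_V B G rho xs x z.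
Proof.
rewrite addr_ge0 ?(spd_spsd hB).2// mulr_ge0 ?(spd_spsd hG).2//.
by rewrite invr_ge0 ltW.
Qed.

End als_algebra.

(** The one-step identity with [b], [xs] and [z] all zero expresses the difference of the two sides
    as a value of [V], which is nonnegative. *)
Lemma sqnorm_als_Z_le (R : realType) m n p (A : 'M[R]_(m, n)) (B : 'M[R]_n)
    (G : 'M[R]_p) rho S e : spd_mx B -> spd_mx G -> 0 < rho ->
  sqnorm_mx (als_Z A B G rho S) e <= sqnorm_mx B e.
Proof.
move=> hB hG hrho.
have := als_V_step hB hG hrho S e 0 (mulmx0 _ A).
rewrite {2}/als_V !sqnorm_mx0 !mulr0 addr0 !subr0 => Vstep.
by rewrite -subr_ge0 -Vstep als_V_ge0.
Qed.

(** * Independence of the samples *)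

Section history.
Context {R : realType} d d' (Omega : measurableType d) (T : measurableType d').
Variables (P : probability Omega R) (S : nat -> {mfun Omega >-> T}).
Variable D : probability T R.
Hypothesis hindep : mutually_independent P (fun k => S k : Omega -> T).
Hypothesis hlaw : forall k, has_law P (S k) D.

(* Rectangles suffice: by uniqueness of measures this identity passes from
   [Y] to the pair [(Y, S k)], so no generated sigma-algebra is needed. *)
Definition indep_of_future k d1 (T1 : measurableType d1) (Y : Omega -> T1) :=
  forall (J : {fset nat}) (U : set T1) (V : nat -> set T),
    (forall j, j \in J -> (k <= j)%N) -> measurable U ->
    (forall j, measurable (V j)) ->
  P (Y @^-1` U `&` \bigcap_(j in [set` J]) (S j @^-1` V j)) =
  (P (Y @^-1` U) * \prod_(j <- J) D (V j))%E.

Lemma measurable_future (J : {fset nat}) (V : nat -> set T) :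
  (forall j, measurable (V j)) ->
  measurable (\bigcap_(j in [set` J]) (S j @^-1` V j)).
Proof.
move=> mV; apply: fin_bigcap_measurable => // j _.
by rewrite -[X in measurable X]setTI; exact: measurable_funP.
Qed.

Lemma indep_of_future0 : indep_of_future 0 (cst tt : Omega -> unit).
Proof.
move=> J U V _ _ mV.
have PJ : P (\bigcap_(j in [set` J]) (S j @^-1` V j)) =
    (\prod_(j <- J) D (V j))%E.
  by rewrite hindep//; apply: eq_bigr => j _; rewrite -(hlaw j (mV j)).
have [Utt|nUtt] := pselect (U tt).
  rewrite (_ : cst tt @^-1` U = setT); last by apply/seteqP; split.
  by rewrite setTI probability_setT mul1e.
rewrite (_ : cst tt @^-1` U = set0); last by apply/seteqP; split.
by rewrite set0I measure0 mul0e.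
Qed.

Lemma indep_of_future_rectangle k d1 (T1 : measurableType d1)
    (Y : Omega -> T1) (J : {fset nat}) (U : set T1) (V0 : set T)
    (V : nat -> set T) :
    indep_of_future k Y -> (forall j, j \in J -> (k < j)%N) ->
    measurable U -> measurable V0 -> (forall j, measurable (V j)) ->
  P ((fun w => (Y w, S k w)) @^-1` (U `*` V0) `&`
     \bigcap_(j in [set` J]) (S j @^-1` V j)) =
  (P (Y @^-1` U) * D V0 * \prod_(j <- J) D (V j))%E.
Proof.
(* The present sample [S k] counts as one more future sample: the index set becomes [J] with [k]
   added, and [V'] places [V0] at [k]. *)
move=> iY kJ mU mV0 mV; pose V' j := if j == k then V0 else V j.
have V'k : V' k = V0 by rewrite /V' eqxx.
have V'J j : j \in J -> V' j = V j.
  by rewrite /V'; case: eqP => // -> /kJ; rewrite ltnn.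
have kNJ : k \notin J by apply/negP => /kJ; rewrite ltnn.
have := iY (k |` J)%fset U V'.
rewrite big_fsetU1//= V'k set_fsetU1 bigcap_setU1 V'k.
rewrite (eq_big_seq (fun j => D (V j))) => [|j /V'J-> //].
rewrite (eq_bigcapr (G := fun j => S j @^-1` V j)) => [|j /V'J-> //].
rewrite muleA setIA => <-//.
- by move=> j /fset1UP[->|/kJ/ltnW].
- by move=> j; rewrite /V'; case: ifP.
Qed.

Section pair.
Variables (k : nat) (d1 : measure_display) (T1 : measurableType d1).
Variable Y : {mfun Omega >-> T1}.
Hypothesis iY : indep_of_future k Y.

Definition history_pair (w : Omega) : T1 * T := (Y w, S k w).

Lemma measurable_history_pair : measurable_fun setT history_pair.
Proof. by apply: measurable_fun_pair; exact: measurable_funP. Qed.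

HB.instance Definition _ :=
  isMeasurableFun.Build _ _ _ _ history_pair measurable_history_pair.

Lemma history_pair_law (X : set (T1 * T)) : measurable X ->
  (distribution P Y \x D)%E X = distribution P history_pair X.
Proof.
apply: product_measure_unique => U V mU mV.
have := @indep_of_future_rectangle k _ _ Y fset0 U V (fun=> setT) iY.
rewrite big_seq_fset0 mule1 => <-//.
by rewrite set_fset0 bigcap_set0 setIT.
Qed.

(** For a fixed future event [C], both sides are finite measures in [X]: [m1] is the image of [P]
    restricted to [C], and [m2] a multiple of the law of the pair. They agree on rectangles, which
    are stable under intersection and generate the product sigma-algebra. *)
Lemma indep_of_future_pair : indep_of_future k.+1 history_pair.
Proof.
move=> J X V kJ mX mV.
set C := \bigcap_(j in _) _.
have mC : measurable C by exact: measurable_future.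
pose m1 := pushforward (mrestr P mC) history_pair.
have c0 : (0 <= \prod_(j <- J) D (V j))%E by apply: prode_ge0.
have cfin : (\prod_(j <- J) D (V j))%E \is a fin_num.
  by apply: prode_fin_num => j _; exact: fin_num_measure.
pose c : {nonneg R} := NngNum (fine_ge0 c0).
have cE : (c%:num%:E = \prod_(j <- J) D (V j))%E by rewrite /= fineK.
pose m2 := mscale c (distribution P history_pair).
suff : m1 X = m2 X.
  by rewrite /m1 /m2 /mscale /= /mrestr /distribution /pushforward cE muleC.
pose G : set (set (T1 * T)) :=
  [set E | exists U V, [/\ measurable U, measurable V & E = U `*` V]].
apply: (measure_unique G (fun=> setT)) => //=.
- rewrite measurable_prod_measurableType//; congr (<<s _ >>).
  apply/seteqP; split => [_ [U mU [W mW <-]]|_ [U [W [mU mW ->]]]].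
    by exists U, W.
  by exists U => //; exists W.
- move=> _ _ [U [W [mU mW ->]]] [U' [W' [mU' mW' ->]]].
  exists (U `&` U'), (W `&` W'); split; [exact: measurableI..|].
  by rewrite setXI.
- by move=> _; exists setT, setT; rewrite setXTT.
- by rewrite bigcup_const//; exists 0%N.
- move=> _ [U [W [mU mW ->]]].
  rewrite /m1 /m2 /mscale /= cE -history_pair_law; last exact: measurableX.
  rewrite product_measure1E//= /pushforward /mrestr.
  by rewrite (indep_of_future_rectangle iY kJ)// muleC.
- move=> _; rewrite /m1 /pushforward /mrestr.
  apply: (@le_lt_trans _ _ 1%E); last exact: ltry.
  by apply: probability_le1; rewrite preimage_setT setTI.
Qed.

(** The law of the pair is a product measure, so Tonelli integrates the fresh sample first with the
    history frozen. This plays the part of conditioning on the past. *)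
Lemma integral_history_pair (f : T1 * T -> \bar R) :
    measurable_fun [set: T1 * T] f -> (forall t, 0 <= f t)%E ->
  (\int[P]_w f (Y w, S k w) = \int[P]_w \int[D]_s f (Y w, s))%E.
Proof.
move=> mf f0; transitivity (\int[distribution P history_pair]_t f t)%E.
  by rewrite ge0_integral_distribution.
transitivity (\int[(distribution P Y \x D)%E]_t f t)%E.
  by apply: eq_measure_integral => X mX _; apply: esym; exact: history_pair_law.
rewrite fubini_tonelli1// ge0_integral_distribution//.
- exact: measurable_fun_fubini_tonelli_F.
- by move=> y; apply: integral_ge0.
Qed.

End pair.

(** The history space is an iterated product growing with [k]; [h] reads sample [j] off a history,
    with the default [point] for indices from [k] on. *)
Lemma exists_history k : exists d1 (T1 : measurableType d1)
    (Y : {mfun Omega >-> T1}) (h : T1 -> nat -> T),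
  [/\ forall j, measurable_fun setT (h ^~ j),
      forall w j, (j < k)%N -> h (Y w) j = S j w & indep_of_future k Y].
Proof.
elim: k => [|k [d1 [T1 [Y [h [mh hY iY]]]]]].
  exists _, unit, (cst tt), (fun _ _ => point); split => //.
  exact: indep_of_future0.
exists _, (T1 * T)%type, (history_pair k Y).
exists (fun t j => if j == k then t.2 else h t.1 j); split => [j|w j|].
- case: (j == k); first exact: measurable_snd.
  exact: measurableT_comp (mh j) measurable_fst.
- by rewrite ltnS leq_eqVlt /=; case: eqP => [->//|_ /=]; exact: hY.
- exact: indep_of_future_pair.
Qed.

End history.

(** * Measurability and expectation of matrices *)

Section measurable_mx.
Context {R : realType} d (T : measurableType d).

Definition measurable_mx q r (X : T -> 'M[R]_(q, r)) :=
  forall i j, measurable_fun setT (fun t => X t i j).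

Lemma measurable_mx_cst q r (M : 'M[R]_(q, r)) : measurable_mx (fun=> M).
Proof. by move=> i j; exact: measurable_cst. Qed.

Lemma measurable_mxD q r (X Y : T -> 'M[R]_(q, r)) :
  measurable_mx X -> measurable_mx Y -> measurable_mx (fun t => X t + Y t).
Proof.
move=> mX mY i j; rewrite (_ : (fun _ => _) = (fun t => X t i j + Y t i j)).
  exact: measurable_funD.
by apply/funext => t; rewrite mxE.
Qed.

Lemma measurable_mxN q r (X : T -> 'M[R]_(q, r)) :
  measurable_mx X -> measurable_mx (fun t => - X t).
Proof.
move=> mX i j; rewrite (_ : (fun _ => _) = (fun t => - (X t i j))).
  exact: measurable_funN.
by apply/funext => t; rewrite mxE.
Qed.

Lemma measurable_mxZ q r (a : T -> R) (X : T -> 'M[R]_(q, r)) :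
  measurable_fun setT a -> measurable_mx X ->
  measurable_mx (fun t => a t *: X t).
Proof.
move=> ma mX i j; rewrite (_ : (fun _ => _) = (fun t => a t * X t i j)).
  exact: measurable_funM.
by apply/funext => t; rewrite mxE.
Qed.

Lemma measurable_mxM q r k (X : T -> 'M[R]_(q, r)) (Y : T -> 'M[R]_(r, k)) :
  measurable_mx X -> measurable_mx Y -> measurable_mx (fun t => X t *m Y t).
Proof.
move=> mX mY i j.
rewrite (_ : (fun _ => _) = (fun t => \sum_l X t i l * Y t l j)).
  by apply: measurable_sum => l; exact: measurable_funM.
by apply/funext => t; rewrite mxE.
Qed.

Lemma measurable_mxT q r (X : T -> 'M[R]_(q, r)) :
  measurable_mx X -> measurable_mx (fun t => (X t)^T).
Proof.
move=> mX i j; rewrite (_ : (fun _ => _) = (fun t => X t j i)); first exact: mX.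
by apply/funext => t; rewrite mxE.
Qed.

Lemma measurable_det q (X : T -> 'M[R]_q) :
  measurable_mx X -> measurable_fun setT (fun t => \det (X t)).
Proof.
move=> mX; apply: measurable_sum => s; apply: measurable_funM.
  exact: measurable_cst.
by apply: measurable_prod => i _; exact: mX.
Qed.

Lemma measurable_funV (f : T -> R) : measurable_fun setT f ->
  (forall t, f t != 0) -> measurable_fun setT (fun t => (f t)^-1).
Proof.
move=> mf f0.
apply: (@measurable_comp _ _ _ _ _ _ [set x : R | x != 0] (@GRing.inv R)) => //.
- by apply: open_measurable; exact: open_neq.
- by move=> _ [t _ <-] /=; exact: f0.
- apply: open_continuous_measurable_fun; first exact: open_neq.
  by move=> x /set_mem /= x0; exact: inv_continuous.
Qed.

(** By Cramer's formula the entries of the inverse are cofactors divided by a nonvanishing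
    determinant. *)
Lemma measurable_invmx q (X : T -> 'M[R]_q) : measurable_mx X ->
  (forall t, X t \in unitmx) -> measurable_mx (fun t => invmx (X t)).
Proof.
move=> mX Xu.
rewrite (_ : (fun _ => _) = (fun t => (\det (X t))^-1 *: \adj (X t)));
    last first.
  by apply/funext => t; rewrite /invmx Xu.
apply: measurable_mxZ.
  apply: measurable_funV => [|t]; first exact: measurable_det.
  by rewrite -unitfE -unitmxE.
move=> i j; rewrite (_ : (fun _ => _) = (fun t => cofactor (X t) j i)).
  apply: measurable_funM; first exact: measurable_cst.
  apply: measurable_det => k l.
  rewrite (_ : (fun _ => _) = (fun t => X t (lift j k) (lift i l))).
    exact: mX.
  by apply/funext => t; rewrite !mxE.
by apply/funext => t; rewrite mxE.
Qed.

Lemma measurable_sqnorm_mx q (M : 'M[R]_q) (X : T -> 'cV[R]_q) :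
  measurable_mx X -> measurable_fun setT (fun t => sqnorm_mx M (X t)).
Proof.
move=> mX; apply: measurable_mxM => //; apply: measurable_mxM.
  exact: measurable_mxT.
exact: measurable_mx_cst.
Qed.

End measurable_mx.

(** Coordinates are continuous, so preimages of open intervals are open sets of matrices. *)
Lemma measurable_borel_mx (R : realType) m p :
  measurable_mx (fun S : borel_mx R m p => S : 'M[R]_(m, p)).
Proof.
move=> i j; apply: (measurability _ (RGenOpens.measurableE R)).
move=> _ [_ [a [c ->]] <-]; rewrite setTI; apply: sub_gen_smallest.
apply: open_comp; last exact: interval_open.
by move=> M _; exact: coord_continuous.
Qed.

Section linear_combination.
Context {R : realType} d (T : measurableType d) (D : probability T R).
Variables (k : nat) (c : 'I_k -> R) (X : 'I_k -> T -> R).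
Hypothesis iX : forall l, D.-integrable setT (fun t => (X l t)%:E).

Let icX l : D.-integrable setT (fun t => (c l)%:E * (X l t)%:E)%E.
Proof. exact: integrableZl. Qed.

Lemma integrable_lin : D.-integrable setT (fun t => (\sum_l c l * X l t)%:E).
Proof.
under eq_fun do rewrite -sumEFin.
by apply: (integrable_sum measurableT) => l _; exact: icX.
Qed.

Lemma expectation_lin : fine 'E_D[fun t => \sum_l c l * X l t] =
  \sum_l c l * fine 'E_D[X l].
Proof.
rewrite unlock; under eq_integral do rewrite -sumEFin.
rewrite (integral_sum measurableT icX) -sum_fine => [|l _]; last first.
  exact: integrable_fin_num (icX l).
apply: eq_bigr => l _.
by rewrite integralZl// fineM// integrable_fin_num.
Qed.

End linear_combination.

Lemma integral_affine (R : realType) d (T : measurableType d)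
    (D : probability T R) (a b c : R) (f g : T -> R) :
    D.-integrable setT (fun t => (f t)%:E) ->
    D.-integrable setT (fun t => (g t)%:E) ->
  (\int[D]_t (c + a * f t + b * g t)%:E =
   (c + a * fine 'E_D[f] + b * fine 'E_D[g])%:E)%E.
Proof.
move=> iF iG; have iaF : D.-integrable setT (fun t => a%:E * (f t)%:E)%E.
  exact: integrableZl.
have ibG : D.-integrable setT (fun t => b%:E * (g t)%:E)%E.
  exact: integrableZl.
have ic : D.-integrable setT (cst c%:E) by exact: finite_measure_integrable_cst.
under eq_integral do rewrite !EFinD !EFinM.
rewrite (integralD measurableT (integrableD measurableT ic iaF) ibG).
have := expectation_cst D c; rewrite unlock => cE.
rewrite (integralD measurableT ic iaF) !integralZl// cE.
rewrite !EFinD !EFinM !fineK//.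
  exact: integrable_fin_num iG.
exact: integrable_fin_num iF.
Qed.

Section expectation_mx.
Context {R : realType} {m p : nat} (D : probability (borel_mx R m p) R).
Local Notation integrableD X :=
  (D.-integrable setT (fun S : borel_mx R m p => (X S : R)%:E)).

Lemma integrable_mxMl q r k (M : 'M[R]_(k, q))
    (X : 'M[R]_(m, p) -> 'M[R]_(q, r)) :
  integrable_mx D X -> integrable_mx D (fun S => M *m X S).
Proof.
move=> iX i j.
rewrite (_ : (fun _ => _) =
    (fun S : borel_mx R m p => (\sum_l M i l * X S l j)%:E)).
  by apply: integrable_lin => l; exact: iX.
by apply/funext => S; rewrite mxE.
Qed.

Lemma expectation_mxMl q r k (M : 'M[R]_(k, q))
    (X : 'M[R]_(m, p) -> 'M[R]_(q, r)) :
  integrable_mx D X ->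
  expectation_mx D (fun S => M *m X S) = M *m expectation_mx D X.
Proof.
move=> iX; apply/matrixP => i j; rewrite !mxE.
rewrite (_ : (fun _ => _) =
    (fun S : borel_mx R m p => \sum_l M i l * X S l j)); last first.
  by apply/funext => S; rewrite mxE.
rewrite expectation_lin => [|l]; last exact: iX.
by apply: eq_bigr => l _; rewrite mxE.
Qed.

Lemma integrable_mxT q r (X : 'M[R]_(m, p) -> 'M[R]_(q, r)) :
  integrable_mx D X -> integrable_mx D (fun S => (X S)^T).
Proof.
move=> iX i j.
rewrite (_ : (fun _ => _) = (fun S : borel_mx R m p => (X S j i)%:E)).
  exact: iX.
by apply/funext => S; rewrite mxE.
Qed.

Lemma expectation_mxT q r (X : 'M[R]_(m, p) -> 'M[R]_(q, r)) :
  expectation_mx D (fun S => (X S)^T) = (expectation_mx D X)^T.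
Proof.
apply/matrixP => i j; rewrite !mxE; congr (fine 'E_D[_]).
by apply/funext => S; rewrite mxE.
Qed.

Lemma integrable_mxMr q r k (M : 'M[R]_(r, k))
    (X : 'M[R]_(m, p) -> 'M[R]_(q, r)) :
  integrable_mx D X -> integrable_mx D (fun S => X S *m M).
Proof.
move=> iX; rewrite (_ : (fun _ => _) = (fun S => (M^T *m (X S)^T)^T)).
  by apply/integrable_mxT/integrable_mxMl/integrable_mxT.
by apply/funext => S; rewrite trmx_mul !trmxK.
Qed.

Lemma expectation_mxMr q r k (M : 'M[R]_(r, k))
    (X : 'M[R]_(m, p) -> 'M[R]_(q, r)) :
  integrable_mx D X ->
  expectation_mx D (fun S => X S *m M) = expectation_mx D X *m M.
Proof.
move=> iX; rewrite (_ : (fun _ => _) = (fun S => (M^T *m (X S)^T)^T)).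
  rewrite expectation_mxT expectation_mxMl; last exact: integrable_mxT.
  by rewrite expectation_mxT trmx_mul !trmxK.
by apply/funext => S; rewrite trmx_mul !trmxK.
Qed.

Lemma integrable_sqnorm q (X : 'M[R]_(m, p) -> 'M[R]_q) v :
  integrable_mx D X -> integrableD (fun S => sqnorm_mx (X S) v).
Proof. by move=> iX; exact/integrable_mxMr/integrable_mxMl. Qed.

Lemma expectation_sqnorm q (X : 'M[R]_(m, p) -> 'M[R]_q) v :
  integrable_mx D X ->
  fine 'E_D[fun S : borel_mx R m p => sqnorm_mx (X S) v] =
  sqnorm_mx (expectation_mx D X) v.
Proof.
move=> iX; rewrite /sqnorm_mx -expectation_mxMl// -expectation_mxMr.
  by rewrite mxE.
exact: integrable_mxMl.
Qed.

Lemma expectation_mx_spsd q (X : 'M[R]_(m, p) -> 'M[R]_q) :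
    integrable_mx D X -> (forall S, spsd_mx (X S)) ->
  spsd_mx (expectation_mx D X).
Proof.
move=> iX X0; split => [|v]; last first.
  rewrite -expectation_sqnorm// fine_ge0// expectation_ge0// => S.
  exact: (X0 S).2.
apply/symmx_trE; rewrite -expectation_mxT; congr (expectation_mx D _).
by apply/funext => S; have [/symmx_trE] := X0 S.
Qed.

Lemma integral_sqnorm_affine q r (X : 'M[R]_(m, p) -> 'M[R]_q)
    (Y : 'M[R]_(m, p) -> 'M[R]_r) (a b c : R) v u :
    integrable_mx D X -> integrable_mx D Y ->
  (\int[D]_S (c + a * sqnorm_mx (X S) v + b * sqnorm_mx (Y S) u)%:E =
  (c + a * sqnorm_mx (expectation_mx D X) v +
     b * sqnorm_mx (expectation_mx D Y) u)%:E)%E.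
Proof.
move=> iX iY; have isqX := integrable_sqnorm v iX.
have isqY := integrable_sqnorm u iY.
by rewrite (integral_affine a b c isqX isqY) !expectation_sqnorm.
Qed.

End expectation_mx.

(** * The iterates and the expected decrease *)

Section als_iterates.
Context {R : realType} {m n p : nat}.
Variables (A : 'M[R]_(m, n)) (b : 'cV[R]_m) (B : 'M[R]_n) (G : 'M[R]_p).
Variable rho : R.
Hypotheses (hB : spd_mx B) (hG : spd_mx G) (hrho : 0 < rho).

Lemma eq_als_iter x0 z0 (S S' : nat -> 'M[R]_(m, p)) k :
  (forall j, (j < k)%N -> S j = S' j) ->
  als_iter A b B G rho x0 z0 S k = als_iter A b B G rho x0 z0 S' k.
Proof.
elim: k => //= k IHk SS'; rewrite SS'// IHk// => j jk.
exact/SS'/ltnW.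
Qed.

Lemma als_iter_range x0 z0 S k xs : A *m xs = b ->
    (exists y, x0 - xs = invmx B *m A^T *m y) ->
  exists y, (als_iter A b B G rho x0 z0 S k).1 - xs = invmx B *m A^T *m y.
Proof.
move=> Axs x0R; elim: k => //= k [y xkE].
set z' := als_H _ _ _ _ _ *m _; exists (y - S k *m z').
by rewrite addrAC xkE mulmxBr !mulmxA.
Qed.

Section measurability.
Context d (T : measurableType d).

Lemma measurable_als_step (S : T -> 'M[R]_(m, p)) x z :
    measurable_mx S -> measurable_mx x -> measurable_mx z ->
  measurable_mx (fun t => (als_step A b B G rho (S t) (x t, z t)).1) /\
  measurable_mx (fun t => (als_step A b B G rho (S t) (x t, z t)).2).
Proof.
move=> mS mx mz; have mST := measurable_mxT mS.
have mA r s (M : 'M[R]_(r, s)) : measurable_mx (fun _ : T => M).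
  exact: measurable_mx_cst.
have mz' : measurable_mx (fun t => (als_step A b B G rho (S t) (x t, z t)).2).
  apply: measurable_mxM.
    apply: measurable_invmx => [|t]; last exact/spd_unitmx/als_invH_spd.
    apply: measurable_mxD; first exact: mA.
    by do !apply: measurable_mxM => //; exact: mA.
  apply: measurable_mxD.
    apply: measurable_mxD; last first.
      by apply: measurable_mxN; apply: measurable_mxM => //; exact: mA.
    by do !apply: measurable_mxM => //; exact: mA.
  apply: measurable_mxZ; first exact: measurable_cst.
  by apply: measurable_mxM => //; exact: mA.
split=> //; apply: measurable_mxD => //; apply: measurable_mxN.
by apply: measurable_mxM mz'; apply: measurable_mxM mS; exact: mA.
Qed.

Lemma measurable_als_iter (S : T -> nat -> 'M[R]_(m, p)) x0 z0 k :
    (forall j, measurable_mx (S ^~ j)) ->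
  measurable_mx (fun t => (als_iter A b B G rho x0 z0 (S t) k).1) /\
  measurable_mx (fun t => (als_iter A b B G rho x0 z0 (S t) k).2).
Proof.
move=> mS; elim: k => [|k [mx mz]] /=.
  by split; exact: measurable_mx_cst.
have [mx' mz'] := measurable_als_step (mS k) mx mz.
have E t : als_iter A b B G rho x0 z0 (S t) k =
    ((als_iter A b B G rho x0 z0 (S t) k).1,
     (als_iter A b B G rho x0 z0 (S t) k).2) by case: als_iter.
by split; [under eq_fun do rewrite E|under eq_fun do rewrite E].
Qed.

Lemma measurable_als_V xs (x : T -> 'cV[R]_n) (z : T -> 'cV[R]_p) :
    measurable_mx x -> measurable_mx z ->
  measurable_fun setT (fun t => als_V B G rho xs (x t) (z t)).
Proof.
move=> mx mz; apply: measurable_funD.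
  apply: measurable_sqnorm_mx; apply: measurable_mxD => //.
apply: measurable_funM; first exact: measurable_cst.
exact: measurable_sqnorm_mx.
Qed.

End measurability.

End als_iterates.

(** * Averaging one step over the fresh sample *)

Section als_expectation.
Context {R : realType} {m n p : nat}.
Variables (A : 'M[R]_(m, n.+1)) (b : 'cV[R]_m).
Variables (B : 'M[R]_n.+1) (G : 'M[R]_p.+1).
Variable rho : R.
Hypotheses (hB : spd_mx B) (hG : spd_mx G) (hrho : 0 < rho).
Variable D : probability (borel_mx R m p.+1) R.
Hypothesis hintH : integrable_mx D (fun S => S *m als_H A B G rho S *m S^T).
Hypothesis hintZ : integrable_mx D (als_Z A B G rho).
Hypothesis hintW : integrable_mx D (als_W A B G rho).
Hypothesis hnull : forall y : 'cV[R]_m,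
  expectation_mx D (fun S => S *m als_H A B G rho S *m S^T) *m y = 0 ->
  A^T *m y = 0.
Hypothesis hW : spd_mx (expectation_mx D (als_W A B G rho)).

Local Notation EZ := (expectation_mx D (als_Z A B G rho)).
Local Notation EW := (expectation_mx D (als_W A B G rho)).
Local Notation mu := (als_mu A B G rho D).
Local Notation eta := (als_eta A B G rho D).
Local Notation V := (als_V B G rho).

Let EZ_spsd : spsd_mx EZ.
Proof. by apply: expectation_mx_spsd => // S; exact: als_Z_spsd. Qed.

Let EW_spsd : spsd_mx EW. Proof. exact: spd_spsd. Qed.

Lemma als_EZE : als_EZ A B G rho D = invsqrt_mx B *m EZ *m invsqrt_mx B.
Proof.
have iX := integrable_mxMl (invsqrt_mx B) hintZ.
by rewrite /als_EZ (expectation_mxMr _ iX) expectation_mxMl.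
Qed.

Lemma als_EWE : als_EW A B G rho D = invsqrt_mx G *m EW *m invsqrt_mx G.
Proof.
have iX := integrable_mxMl (invsqrt_mx G) hintW.
by rewrite /als_EW (expectation_mxMr _ iX) expectation_mxMl.
Qed.

(** Since [EZ = A^T *m E *m A] with [E] positive semidefinite, [EZ *m v = 0] gives
    [E *m (A *m v) = 0]. The null space assumption turns this into [A^T *m A *m v = 0], so [A *m v]
    has length zero. *)
Lemma expectation_Z_null (v : 'cV[R]_n.+1) : EZ *m v = 0 -> A *m v = 0.
Proof.
set E := expectation_mx D (fun S => S *m als_H A B G rho S *m S^T).
have EZE : EZ = A^T *m E *m A.
  rewrite /E -expectation_mxMl//.
  rewrite -(expectation_mxMr _ (integrable_mxMl _ hintH)).
  by congr (expectation_mx D _); apply/funext => S; rewrite !mulmxA.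
have Epsd : spsd_mx E.
  apply: expectation_mx_spsd => // S; rewrite -{1}[S]trmxK.
  exact/spsd_congr/spd_spsd/als_H_spd.
move=> EZv; have iB := spd_inv hB.
have /(spsd_sqnorm_eq0 Epsd)/hnull AAv : sqnorm_mx E (A *m v) = 0.
  by rewrite sqnorm_mxM -EZE /sqnorm_mx -mulmxA EZv mulmx0 mxE.
apply/eqP; rewrite -sqnorm_mx1_eq0 /sqnorm_mx mulmx1 trmx_mul -mulmxA AAv.
by rewrite mulmx0 mxE.
Qed.

Let EW_neq0 : EW != 0.
Proof.
apply/eqP => EW0; have /hW.2 : (const_mx 1 : 'cV[R]_p.+1) != 0.
  by apply/eqP => /matrixP/(_ 0 0)/eqP; rewrite !mxE oner_eq0.
by rewrite EW0 /sqnorm_mx mulmx0 mul0mx mxE ltxx.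
Qed.

(** If [EZ] vanished, every basis vector would be in the kernel of [A]; then [A = 0] and
    [EW = 0]. *)
Let EZ_neq0 : EZ != 0.
Proof.
apply: contra_neq EW_neq0 => EZ0.
have A0 : A = 0.
  apply/matrixP => i j; have := @expectation_Z_null (delta_mx j 0).
  rewrite EZ0 mul0mx => /(_ erefl); rewrite -colE => /matrixP/(_ i 0).
  by rewrite !mxE.
apply/matrixP => i j; rewrite !mxE (_ : (fun _ => _) = cst 0).
  by rewrite expectation_cst.
by apply/funext => S; rewrite /als_W A0 mulmx0 !mul0mx mxE.
Qed.

Lemma als_mu_gt0 : 0 < mu.
Proof.
by rewrite lt_min als_EZE als_EWE !lambda_min_pos_invsqrt_gt0.
Qed.

(** The samplewise domination of [Z] by [B] passes to the expectation. The bound keeps [1 - mu]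
    nonnegative, as iterating the contraction requires. *)
Lemma als_mu_le1 : mu <= 1.
Proof.
rewrite ge_min als_EZE lambda_min_pos_invsqrt_le1// => e.
rewrite -expectation_sqnorm// -lee_fin fineK; last first.
  by rewrite unlock; exact: integrable_fin_num (integrable_sqnorm e hintZ).
rewrite -(expectation_cst D) unlock; apply: ge0_le_integral => //=.
- by move=> S _; rewrite lee_fin; exact: (als_Z_spsd _ _ _ _ _).2.
- exact: measurable_int (integrable_sqnorm e hintZ).
- by move=> S _; rewrite lee_fin sqnorm_als_Z_le.
Qed.

Lemma als_eta_ge0 : 0 <= eta.
Proof. by rewrite le_max als_EZE lambda_max_invsqrt_ge0. Qed.

Lemma als_fE xs x z : als_f A B G rho D xs x z =
  2^-1 * sqnorm_mx EZ (x - xs) + (2 * rho)^-1 * sqnorm_mx EW z.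
Proof.
have := integral_sqnorm_affine 2^-1 (2 * rho)^-1 0 (x - xs) z hintZ hintW.
rewrite /als_f unlock; under eq_integral do rewrite add0r.
by move=> ->; rewrite add0r.
Qed.

Lemma als_f_ge0 xs x z : 0 <= als_f A B G rho D xs x z.
Proof.
rewrite als_fE addr_ge0// mulr_ge0 ?EZ_spsd.2 ?EW_spsd.2// invr_ge0 //.
by rewrite mulr_ge0// ltW.
Qed.

Lemma als_f_le_V xs x z :
  als_f A B G rho D xs x z <= eta / 2 * V xs x z.
Proof.
have Z_le : sqnorm_mx EZ (x - xs) <= eta * sqnorm_mx B (x - xs).
  apply: (le_trans (lambda_max_invsqrt hB EZ_spsd _)).
  by rewrite ler_wpM2r ?(spd_spsd hB).2// -als_EZE le_max lexx.
have W_le : sqnorm_mx EW z <= eta * sqnorm_mx G z.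
  apply: (le_trans (lambda_max_invsqrt hG EW_spsd _)).
  by rewrite ler_wpM2r ?(spd_spsd hG).2// -als_EWE le_max lexx orbT.
have irho : 0 <= rho^-1 by rewrite invr_ge0 ltW.
have W_le' := ler_wpM2l irho W_le.
rewrite als_fE /als_V invfM -mulrA; lra.
Qed.

Lemma integral_als_V_step xs x z : A *m xs = b ->
    (exists y, x - xs = invmx B *m A^T *m y) ->
  (\int[D]_S (V xs (als_step A b B G rho S (x, z)).1
                  (als_step A b B G rho S (x, z)).2)%:E <=
   ((1 - mu) * V xs x z)%:E)%E.
Proof.
move=> Axs [y xE].
rewrite [leLHS](_ : _ = (V xs x z + -1 * sqnorm_mx EZ (x - xs) +
    - rho^-1 * sqnorm_mx EW z)%:E); last first.
  rewrite -integral_sqnorm_affine//; apply: eq_integral => S _.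
  by rewrite als_V_step// mulN1r mulNr.
rewrite lee_fin.
have Z_ge : mu * sqnorm_mx B (x - xs) <= sqnorm_mx EZ (x - xs).
  apply: (@le_trans _ _
      (lambda_min_pos (als_EZ A B G rho D) * sqnorm_mx B (x - xs))).
    by rewrite ler_wpM2r ?(spd_spsd hB).2// ge_min lexx.
  rewrite als_EZE xE; apply: lambda_min_pos_invsqrt => //.
  exact: expectation_Z_null.
have W_ge : mu * sqnorm_mx G z <= sqnorm_mx EW z.
  apply: (@le_trans _ _ (lambda_min_pos (als_EW A B G rho D) * sqnorm_mx G z)).
    by rewrite ler_wpM2r ?(spd_spsd hG).2// ge_min lexx orbT.
  (* The range condition is void for [z]: with [C := G] every [z] is [invmx G *m G^T *m z], and [EW]
     has trivial kernel. *)
  have Gu := spd_unitmx hG; have [/symmx_trE Gsym _] := hG.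
  have := lambda_min_pos_invsqrt hG EW_spsd (C := G) z.
  rewrite Gsym mulVmx// mul1mx als_EWE; apply => v EWv.
  by rewrite -[v](mulKmx (spd_unitmx hW)) EWv !mulmx0.
have irho : 0 <= rho^-1 by rewrite invr_ge0 ltW.
have W_ge' := ler_wpM2l irho W_ge.
rewrite /als_V; lra.
Qed.

End als_expectation.

(** * Convergence *)

Lemma ge0_expectation_le (R : realType) d (T : measurableType d)
    (P : probability T R) (X Y : T -> R) :
    measurable_fun setT Y -> (forall t, 0 <= X t) -> measurable_fun setT X ->
  (forall t, X t <= Y t) -> ('E_P[X] <= 'E_P[Y])%E.
Proof.
move=> mY X0 mX XY; rewrite unlock; apply: ge0_le_integral => //=.
- by move=> t _; rewrite lee_fin.
- exact/measurable_EFinP.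
- exact/measurable_EFinP.
- by move=> t _; rewrite lee_fin.
Qed.

Lemma ge0_expectationZl (R : realType) d (T : measurableType d)
    (P : probability T R) (X : T -> R) (c : R) :
    measurable_fun setT X -> (forall t, 0 <= X t) -> 0 <= c ->
  ('E_P[fun t => (c * X t)%R] = c%:E * 'E_P[X])%E.
Proof.
move=> mX X0 c0; rewrite unlock; under eq_integral do rewrite EFinM.
rewrite ge0_integralZl_EFin//; first by move=> t _; rewrite lee_fin.
exact/measurable_EFinP.
Qed.

Lemma measurable_mx_comp (R : realType) d (T : measurableType d) m p
    (S : T -> borel_mx R m p) :
  measurable_fun setT S -> measurable_mx (S : T -> 'M[R]_(m, p)).
Proof.
move=> mS i j; exact: (measurableT_comp (measurable_borel_mx i j) mS).
Qed.

Section als_convergence.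
Context {R : realType} {m n p : nat}.
Variables (A : 'M[R]_(m, n.+1)) (b : 'cV[R]_m).
Variables (B : 'M[R]_n.+1) (G : 'M[R]_p.+1).
Variable rho : R.
Hypotheses (hB : spd_mx B) (hG : spd_mx G) (hrho : 0 < rho).
Variable D : probability (borel_mx R m p.+1) R.
Hypothesis hintH : integrable_mx D (fun S => S *m als_H A B G rho S *m S^T).
Hypothesis hintZ : integrable_mx D (als_Z A B G rho).
Hypothesis hintW : integrable_mx D (als_W A B G rho).
Hypothesis hnull : forall y : 'cV[R]_m,
  expectation_mx D (fun S => S *m als_H A B G rho S *m S^T) *m y = 0 ->
  A^T *m y = 0.
Hypothesis hW : spd_mx (expectation_mx D (als_W A B G rho)).
Context {d : measure_display} {Omega : measurableType d}.
Variables (P : probability Omega R) (S : nat -> {RV P >-> borel_mx R m p.+1}).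
Hypothesis hindep :
  mutually_independent P (fun k => S k : Omega -> borel_mx R m p.+1).
Hypothesis hlaw : forall k, has_law P (S k) D.
Variables (x0 xs : 'cV[R]_n.+1) (z0 : 'cV[R]_p.+1).
Hypothesis Axs : A *m xs = b.
Hypothesis x0R : exists y, x0 - xs = invmx B *m A^T *m y.

Local Notation mu := (als_mu A B G rho D).
Local Notation als h k := (als_iter A b B G rho x0 z0 h k).
Local Notation V := (als_V B G rho xs).
Let Vk (k : nat) (w : Omega) : R :=
  V (als (fun j => S j w) k).1 (als (fun j => S j w) k).2.

Lemma measurable_sample_iter k :
  measurable_mx (fun w => (als (fun j => S j w) k).1) /\
  measurable_mx (fun w => (als (fun j => S j w) k).2).
Proof.
have mS j : measurable_mx (fun w => S j w : 'M[R]_(m, p.+1)).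
  by apply: measurable_mx_comp; exact: measurable_funP.
by have := measurable_als_iter A b hB hG hrho x0 z0 k mS.
Qed.

Lemma measurable_sample_V k : measurable_fun setT (Vk k).
Proof.
by have [mx mz] := measurable_sample_iter k; exact: measurable_als_V.
Qed.

(** The iterate [k] is a function [X] of the history [Y], and the next value of [V] is a function
    [f] of [Y] and the independent sample [S k]. Integrating [S k] out first allows the one-step
    bound for each fixed history. *)
Lemma expectation_V_step k : ('E_P[Vk k.+1] <= (1 - mu)%:E * 'E_P[Vk k])%E.
Proof.
have [d1 [T1 [Y [h [mh hY iY]]]]] := exists_history hindep hlaw k.
pose X y := als (h y) k.
have iterE w : als (fun j => S j w) k = X (Y w).
  by apply: eq_als_iter => j jk; rewrite hY.
have VkE w : Vk k w = V (X (Y w)).1 (X (Y w)).2 by rewrite /Vk iterE.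
pose f (t : T1 * borel_mx R m p.+1) : \bar R :=
  (V (als_step A b B G rho t.2 (X t.1)).1
     (als_step A b B G rho t.2 (X t.1)).2)%:E.
have Vk1E w : (Vk k.+1 w)%:E = f (Y w, S k w).
  by rewrite /f /= /Vk /= iterE.
have f0 t : (0 <= f t)%E by rewrite lee_fin als_V_ge0.
have mf : measurable_fun [set: T1 * borel_mx R m p.+1] f.
  have mS j : measurable_mx
      (fun t : T1 * borel_mx R m p.+1 => h t.1 j : 'M[R]_(m, p.+1)).
    apply: measurable_mx_comp.
    exact: measurableT_comp (mh j) measurable_fst.
  have [mx mz] := measurable_als_iter A b hB hG hrho x0 z0 k mS.
  have ms : measurable_mx
      (fun t : T1 * borel_mx R m p.+1 => t.2 : 'M[R]_(m, p.+1)).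
    by apply: measurable_mx_comp; exact: measurable_snd.
  have [mx' mz'] := measurable_als_step A b hB hG hrho ms mx mz.
  apply/measurable_EFinP/measurable_als_V.
    by under eq_fun do rewrite [X _]surjective_pairing.
  by under eq_fun do rewrite [X _]surjective_pairing.
rewrite -ge0_expectationZl; last 3 first.
- exact: measurable_sample_V.
- by move=> w; exact: als_V_ge0.
- by rewrite subr_ge0 als_mu_le1.
rewrite unlock; under eq_integral do rewrite Vk1E.
rewrite (integral_history_pair iY mf f0).
apply: ge0_le_integral => //=.
- by move=> w _; apply: integral_ge0.
- have := measurable_fun_fubini_tonelli_F (m2 := D) f mf f0.
  by move=> /measurableT_comp; apply; exact: measurable_funP.
- apply/measurable_EFinP; apply: measurable_funM; first exact: measurable_cst.
  exact: measurable_sample_V.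
- move=> w _; rewrite VkE /f /=.
  under eq_integral do rewrite [X _]surjective_pairing.
  apply: integral_als_V_step => //.
  exact: als_iter_range.
Qed.

Lemma expectation_V_le k :
  ('E_P[Vk k] <= ((1 - mu) ^+ k)%:E * 'E_P[Vk 0%N])%E.
Proof.
elim: k => [|k IHk]; first by rewrite expr0 mul1e.
apply: (le_trans (expectation_V_step k)); rewrite exprS EFinM -muleA.
by rewrite lee_wpmul2l// lee_fin subr_ge0 als_mu_le1.
Qed.

Lemma expectation_V0 : ('E_P[Vk 0%N] = (V x0 z0)%:E)%E.
Proof. by have := expectation_cst P (V x0 z0). Qed.

(** Stated for any nonnegative [F] dominated by a multiple of [V], so that it serves both for the
    error in [x] and for [z]. *)
Lemma expectation_V_cvg0 (F : nat -> Omega -> R) :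
    (forall k, measurable_fun setT (F k)) ->
    (forall k w, 0 <= F k w) ->
    (exists2 c : R, 0 <= c & forall k w, F k w <= c * Vk k w) ->
  'E_P[F k]%E @[k --> \oo] --> 0%E.
Proof.
move=> mF F0 [c c0 FV].
have E_le k : ('E_P[F k] <= ((1 - mu) ^+ k * (c * V x0 z0))%:E)%E.
  apply: (@le_trans _ _ (c%:E * 'E_P[Vk k])%E).
    rewrite -ge0_expectationZl//; [|exact: measurable_sample_V|].
      apply: ge0_expectation_le => //; apply: measurable_funM => //.
      exact: measurable_sample_V.
    by move=> w; exact: als_V_ge0.
  apply: (@le_trans _ _ (c%:E * (((1 - mu) ^+ k)%:E * 'E_P[Vk 0%N])))%E.
    by rewrite lee_wpmul2l// expectation_V_le.
  by rewrite expectation_V0 -!EFinM mulrCA.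
apply: (@squeeze_cvge _ _ _ _ (fun=> 0%E) _
    (fun k => ((1 - mu) ^+ k * (c * V x0 z0))%:E)).
- by near=> k; rewrite E_le andbT expectation_ge0.
- exact: cvg_cst.
- apply: cvg_EFin; first by near=> k.
  rewrite -[X in _ --> X](mul0r (c * V x0 z0)).
  rewrite (_ : _ \o _ = (fun k => (1 - mu) ^+ k * (c * V x0 z0))) //.
  apply: cvgM; last exact: cvg_cst.
  apply: cvg_expr.
  (* The ratio [1 - mu] lies in [[0, 1)] because [0 < mu <= 1]. *)
  by rewrite ger0_norm ?subr_ge0 ?als_mu_le1// ltrBlDr ltrDl als_mu_gt0.
Unshelve. all: by end_near. Qed.

End als_convergence.

Theorem theorem3p6 (R : realType) (m n p : nat)
    (hm : (0 < m)%N) (hn : (0 < n)%N) (hp : (0 < p)%N)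
    (A : 'M[R]_(m, n)) (b : 'cV[R]_m)
    (hAb : exists x : 'cV[R]_n, A *m x = b)
    (B : 'M[R]_n) (G : 'M[R]_p) (hB : spd_mx B) (hG : spd_mx G)
    (rho : R) (hrho : 0 < rho)
    (D : probability (borel_mx R m p) R)
    (* all the expectations over D exist *)
    (hintH : integrable_mx D (fun S => S *m als_H A B G rho S *m S^T))
    (hintZ : integrable_mx D (als_Z A B G rho))
    (hintW : integrable_mx D (als_W A B G rho))
    (* standing assumption on D *)
    (hnull : forall y : 'cV[R]_m,
      expectation_mx D (fun S => S *m als_H A B G rho S *m S^T) *m y = 0 ->
      A^T *m y = 0)
    (hW : spd_mx (expectation_mx D (als_W A B G rho)))
    (* the independent samples drawn from D *)
    (d : measure_display) (Omega : measurableType d) (P : probability Omega R)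
    (S : nat -> {RV P >-> borel_mx R m p})
    (hindep : mutually_independent P (fun k => S k : Omega -> borel_mx R m p))
    (hlaw : forall k, has_law P (S k) D)
    (x0 : 'cV[R]_n) (z0 : 'cV[R]_p) :
  let x (k : nat) (w : Omega) :=
    (als_iter A b B G rho x0 z0 (fun j => S j w) k).1 in
  let z (k : nat) (w : Omega) :=
    (als_iter A b B G rho x0 z0 (fun j => S j w) k).2 in
  let xs := B_projection A b B x0 in
  let mu := als_mu A B G rho D in
  let eta := als_eta A B G rho D in
  [/\ 'E_P[fun w => sqnorm_mx B (x k w - xs)]%E @[k --> \oo] --> 0%E,
      'E_P[fun w => sqnorm_mx G (z k w)]%E @[k --> \oo] --> 0%E,
      forall k : nat,
        ('E_P[fun w => als_V B G rho xs (x k.+1 w) (z k.+1 w)] <=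
         ((1 - mu) ^+ k.+1)%:E *
           'E_P[fun w => als_V B G rho xs (x 0%N w) (z 0%N w)])%E
    & forall k : nat,
        ('E_P[fun w => als_f A B G rho D xs (x k.+1 w) (z k.+1 w)] <=
         (eta / 2 * (1 - mu) ^+ k.+1)%:E *
           'E_P[fun w => als_V B G rho xs (x 0%N w) (z 0%N w)])%E].
Proof.
move=> x z xs mu eta.
(* The spectral lemmas are stated for dimensions of the form [n.+1]; positivity of [n] and [p] gives
   this form. *)
case: n => [//|n']
  in hn A hAb B hB hintH hintZ hintW hnull hW x0 @x @z @xs @mu @eta *.
case: p => [//|p']
  in hp G hG D hintH hintZ hintW hnull hW S hindep hlaw z0
     @x @z @xs @mu @eta *.
have [Axs x0R] := B_projectionP x0 hB hAb.
have mxz := measurable_sample_iter A b hB hG hrho S x0 z0.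
have B0 := (spd_spsd hB).2; have G0 := (spd_spsd hG).2.
have V_le := expectation_V_le
  hB hG hrho hintH hintZ hintW hnull hW hindep hlaw z0 Axs x0R.
have E0 := expectation_V_cvg0
  hB hG hrho hintH hintZ hintW hnull hW hindep hlaw Axs x0R.
have mxs k : measurable_mx (fun w => x k w - xs).
  by apply: measurable_mxD; [exact: (mxz k).1|exact: measurable_mx_cst].
split.
- apply: (E0 z0) => [k|k w|]; [exact: measurable_sqnorm_mx|exact: B0|].
  exists 1 => // k w; rewrite mul1r lerDl mulr_ge0 ?invr_ge0 ?G0//.
  exact: ltW.
- apply: (E0 z0) => [k|k w|]; [|exact: G0|].
    by apply: measurable_sqnorm_mx; exact: (mxz k).2.
  (* The factor [rho] undoes the weight [rho^-1] of the [z] term in [V]. *)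
  exists rho => [|k w]; first exact: ltW.
  rewrite mulrDr mulrA divff ?gt_eqF// mul1r lerDr mulr_ge0 ?B0//.
  exact: ltW.
- by move=> k; exact: V_le.
- move=> k; have eta0 := als_eta_ge0 hB hG hrho hintH hintZ hnull hW.
  have mV := measurable_als_V B G rho xs (mxz k.+1).1 (mxz k.+1).2.
  (* The pointwise bound of [f] by [eta / 2] times [V] is integrated first; the decay of the
     expectation of [V] is then multiplied by the nonnegative [eta / 2]. *)
  apply: (@le_trans _ _ ((eta / 2)%:E *
      'E_P[fun w => als_V B G rho xs (x k.+1 w) (z k.+1 w)])%E).
    rewrite -ge0_expectationZl//; last 2 first.
    + by move=> w; exact: als_V_ge0.
    + by rewrite divr_ge0.
    apply: ge0_expectation_le.
    + by apply: measurable_funM => //; exact: measurable_cst.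
    + by move=> w; exact: als_f_ge0.
    + under eq_fun do rewrite als_fE//.
      apply: measurable_funD; apply: measurable_funM => //.
        exact: measurable_sqnorm_mx.
      by apply: measurable_sqnorm_mx; exact: (mxz k.+1).2.
    + by move=> w; exact: als_f_le_V.
  rewrite [in leRHS]EFinM -[in leRHS]muleA lee_wpmul2l//.
    by rewrite lee_fin divr_ge0.
  exact: V_le.
Qed.
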